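(* Let $L$ be a language consisting of relation symbols and unary function symbols equipped with a permutation group $\Gamma_L$ and let $\mathcal E$ be a class of finite $\Gamma_L$-structures which has EPPA. Let $\mathcal K$ be a hereditary locally finite automorphism-preserving subclass of $\mathcal E$ with the strong amalgamation property which consists of irreducible structures. Then $\mathcal K$ has EPPA. Moreover, if EPPA-witnesses in $\mathcal E$ can be chosen to be coherent, then EPPA-witnesses in $\mathcal K$ can be chosen to be coherent, too.
   Context: Structures. A language $L$ consists of relation symbols $R$ (of arity $a(R)\ge 1$) and function symbols $F$ (of arity $a(F)\ge 0$; $F$ is unary if $a(F)=1$). $L$ is equipped with a permutation group $\Gamma_L$ if $\Gamma_L$ is a group of permutations of $L$ mapping relation symbols to relation symbols and function symbols to function symbols and preserving arities. A $\Gamma_L$-structure $\mathbf A$ has a finite or countably infinite vertex set $A$, a relation $R_{\mathbf A}\subseteq A^{a(R)}$ for each relation symbol $R\in L$, and a function $F_{\mathbf A}\colon A^{a(F)}\to\mathcal P(A)$ (the power set of $A$) for each function symbol $F\in L$. It is finite if $A$ is finite. Maps. A homomorphism $f\colon\mathbf A\to\mathbf B$ is a pair $f=(f_L,f_A)$ with $f_L\in\Gamma_L$ and $f_A\colon A\to B$ such that, for all $R,F\in L$ and all tuples $\bar x$, $\bar x\in R_{\mathbf A}$ implies $f_A(\bar x)\in f_L(R)_{\mathbf B}$, and $f_A(F_{\mathbf A}(\bar x))\subseteq f_L(F)_{\mathbf B}(f_A(\bar x))$. It is an embedding if $f_A$ is injective, the implication is an equivalence and the inclusion is an equality. An isomorphism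 is an embedding with $f_A$ bijective; an automorphism is an isomorphism of a structure to itself; $\mathrm{Aut}(\mathbf A)$ is the group of automorphisms. Maps compose componentwise (language parts and vertex parts). $\mathbf A$ is a substructure of $\mathbf B$ if $A\subseteq B$ and the pair ($\mathrm{id}_L$, inclusion) is an embedding. For an embedding $f\colon\mathbf A\to\mathbf B$, $f(\mathbf A)$ is the substructure of $\mathbf B$ with vertex set $f_A(A)$. Amalgamation and irreducibility. Given embeddings $\alpha_i\colon\mathbf A\to\mathbf B_i$ ($i=1,2$), an amalgamation of $\mathbf B_1,\mathbf B_2$ over $\mathbf A$ with respect to $\alpha_1,\alpha_2$ is a structure $\mathbf C$ with embeddings $\beta_i\colon\mathbf B_i\to\mathbf C$ such that $\beta_1\alpha_1=\beta_2\alpha_2$ (including language parts). It is strong if $\beta_1(B_1)\cap\beta_2(B_2)=\beta_1\alpha_1(A)$. A strong amalgamation is free if $C=\beta_1(B_1)\cup\beta_2(B_2)$ and whenever a tuple $\bar x$ of vertices of $\mathbf C$ contains vertices of both $\beta_1(B_1\setminus\alpha_1(A))$ and $\beta_2(B_2\setminus\alpha_2(A))$, then $\bar x$ is in no relation of $\mathbf C$ and $F_{\mathbf C}(\bar x)=\emptyset$ for every $F\in L$ of the corresponding arity. A structure is irreducible if it is not a free amalgamation of two of its proper substructures (over a common substructure, with respect to inclusions). A homomorphism $f\colon\mathbf A\to\mathbf B$ is a homomorphism-embedding if its restriction to every irreducible substructure of $\mathbf A$ is an embedding. A class $\mathcal K$ is hereditary if $\mathbf B\in\mathcal K$ and $\mathbf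 A$ embedding into $\mathbf B$ imply $\mathbf A\in\mathcal K$. It has the strong amalgamation property if for all $\mathbf A,\mathbf B_1,\mathbf B_2\in\mathcal K$ and embeddings $\alpha_i\colon\mathbf A\to\mathbf B_i$ there is $\mathbf C\in\mathcal K$ which is a strong amalgamation of $\mathbf B_1,\mathbf B_2$ over $\mathbf A$ with respect to $\alpha_1,\alpha_2$. Completions. An irreducible structure $\mathbf C'$ is a completion of a structure $\mathbf C$ if there is a homomorphism-embedding $\mathbf C\to\mathbf C'$. It is a strong completion if the homomorphism-embedding is injective. A completion is automorphism-preserving if it is strong and (identifying $\mathbf C$ with its image under the injective homomorphism-embedding $f\colon\mathbf C\to\mathbf C'$) for every $\alpha\in\mathrm{Aut}(\mathbf C)$ there is $\alpha'\in\mathrm{Aut}(\mathbf C')$ extending $\alpha$, i.e. $\alpha'f=f\alpha$, and moreover the map $\alpha\mapsto\alpha'$ is a group homomorphism $\mathrm{Aut}(\mathbf C)\to\mathrm{Aut}(\mathbf C')$. Local finiteness. Let $\mathcal E$ be a class of finite $\Gamma_L$-structures and $\mathcal K\subseteq\mathcal E$ a subclass consisting of irreducible structures. $\mathcal K$ is a locally finite subclass of $\mathcal E$ if for every $\mathbf A\in\mathcal K$ and every $\mathbf B_0\in\mathcal E$ there is a finite integer $n=n(\mathbf A,\mathbf B_0)$ such that every finite $\Gamma_L$-structure $\mathbf B$ has a completion $\mathbf B'\in\mathcal K$, provided that: (1) every irreducible substructure of $\mathbf B$ has an embedding to $\mathbf A$; (2) there is a homomorphism-embedding from $\mathbf B$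 to $\mathbf B_0$; and (3) every substructure of $\mathbf B$ on at most $n$ vertices has a completion in $\mathcal K$. It is a locally finite automorphism-preserving subclass if $\mathbf B'$ can always be chosen to be an automorphism-preserving completion. EPPA. A partial automorphism of $\mathbf A$ is an isomorphism $f$ between substructures of $\mathbf A$; its language part $f_L\in\Gamma_L$ is part of the data, and $\mathrm{dom}(f)$, $\mathrm{range}(f)$ refer to its vertex part. An automorphism $\theta$ extends $f$ if $\theta$ has the same language part as $f$ and its vertex part extends that of $f$. A finite $\mathbf B$ is an EPPA-witness for a finite $\mathbf A$ if there is an embedding $\psi\colon\mathbf A\to\mathbf B$ such that every partial automorphism of $\psi(\mathbf A)$ extends to an automorphism of $\mathbf B$. It is coherent if moreover (for this $\psi$) one can choose, for each partial automorphism $f$ of $\psi(\mathbf A)$, an automorphism $\hat f$ of $\mathbf B$ extending $f$ so that $\widehat{gf}=\hat g\hat f$ whenever $\mathrm{range}(f)=\mathrm{dom}(g)$. A class $\mathcal K$ of finite $\Gamma_L$-structures has EPPA if every $\mathbf A\in\mathcal K$ has an EPPA-witness $\mathbf B\in\mathcal K$; EPPA-witnesses in $\mathcal K$ can be chosen to be coherent if every $\mathbf A\in\mathcal K$ has a coherent EPPA-witness in $\mathcal K$. *)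

(* Defs.v *)
From mathcomp Require Import all_boot.
From mathcomp Require Import all_classical.
From Stdlib Require List.

Set Implicit Arguments.
Unset Strict Implicit.
Unset Printing Implicit Defensive.

Local Open Scope classical_set_scope.

Record language := Language {
  rel_sym : Type;
  fun_sym : Type;
  rel_arity : rel_sym -> nat;
  fun_arity : fun_sym -> nat;
  rel_arity_gt0 : forall R, 0 < rel_arity R }.

Arguments rel_arity {l} R.
Arguments fun_arity {l} F.

(* A self-map of the set of symbols sending relation symbols to relation
   symbols and function symbols to function symbols. *)
Record lmap (L : language) := LMap {
  on_rel : rel_sym L -> rel_sym L;
  on_fun : fun_sym L -> fun_sym L }.

Definition lmap_id (L : language) : lmap L := LMap id id.

Definition lmap_comp (L : language) (s t : lmap L) : lmap L :=
  LMap (on_rel s \o on_rel t) (on_fun s \o on_fun t).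

(* The elements of the group are permutations because of [lpg_inv]. *)
Record lperm_group (L : language) := LPermGroup {
  lpg_mem :> lmap L -> Prop;
  lpg_id : lpg_mem (lmap_id L);
  lpg_comp : forall s t, lpg_mem s -> lpg_mem t -> lpg_mem (lmap_comp s t);
  lpg_inv : forall s, lpg_mem s -> exists2 t, lpg_mem t &
    lmap_comp s t = lmap_id L /\ lmap_comp t s = lmap_id L;
  lpg_rel_arity : forall s R, lpg_mem s -> rel_arity (on_rel s R) = rel_arity R;
  lpg_fun_arity : forall s F, lpg_mem s -> fun_arity (on_fun s F) = fun_arity F }.

(* A tuple of vertices is a sequence whose size is the arity of the symbol it
   is fed to; this avoids transporting tuples along equalities of arities.
   Relations contain only sequences of the right size, and functions take the
   dummy value [set0] on sequences of the wrong size. *)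
Record structure (L : language) := Struct {
  vert :> Type;
  vert_countable : countable [set: vert];
  rel_in : rel_sym L -> set (seq vert);
  fun_in : fun_sym L -> seq vert -> set vert;
  rel_in_size : forall R x, rel_in R x -> size x = rel_arity R;
  fun_in_size : forall F x, size x <> fun_arity F -> fun_in F x = set0 }.

Definition finite_structure (L : language) (A : structure L) : Prop :=
  finite_set [set: A].

Record smap (L : language) (A B : structure L) := SMap {
  lpart : lmap L;
  vpart :> A -> B }.

Definition smap_comp (L : language) (A B C : structure L)
    (g : smap B C) (f : smap A B) : smap A C :=
  SMap (lmap_comp (lpart g) (lpart f)) (g \o f).

Definition is_hom (L : language) (G : lperm_group L) (A B : structure L)
    (f : smap A B) : Prop :=
  [/\ G (lpart f),
      forall R (x : seq A), rel_in R x -> rel_in (on_rel (lpart f) R) (map f x)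
    & forall F (x : seq A),
        f @` fun_in F x `<=` fun_in (on_fun (lpart f) F) (map f x)].

Definition is_emb (L : language) (G : lperm_group L) (A B : structure L)
    (f : smap A B) : Prop :=
  [/\ G (lpart f), injective f,
      forall R (x : seq A),
        rel_in R x <-> rel_in (on_rel (lpart f) R) (map f x)
    & forall F (x : seq A),
        f @` fun_in F x = fun_in (on_fun (lpart f) F) (map f x)].

Definition is_iso (L : language) (G : lperm_group L) (A B : structure L)
    (f : smap A B) : Prop :=
  is_emb G f /\ bijective f.

Definition is_aut (L : language) (G : lperm_group L) (A : structure L)
    (f : smap A A) : Prop :=
  is_iso G f.

Lemma induced_countable (L : language) (A : structure L) (U : set A) :
  countable [set: set_type U].
Proof.
have /countable_injP[f finj] := vert_countable A.
apply/countable_injP; exists (fun u : set_type U => f (\val u)).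
by move=> u v _ _ /finj uv; apply/val_inj/uv; rewrite in_setE.
Qed.

Lemma induced_rel_size (L : language) (A : structure L) (U : set A)
    (R : rel_sym L) (x : seq (set_type U)) :
  rel_in R (map val x) -> size x = rel_arity R.
Proof. by move=> /rel_in_size; rewrite size_map. Qed.

Lemma induced_fun_size (L : language) (A : structure L) (U : set A)
    (F : fun_sym L) (x : seq (set_type U)) :
  size x <> fun_arity F ->
  [set u : set_type U | fun_in F (map val x) (\val u)] = set0.
Proof.
move=> xF; rewrite -subset0 => u /=.
by rewrite fun_in_size // size_map.
Qed.

Definition induced (L : language) (A : structure L) (U : set A) : structure L :=
  @Struct L (set_type U) (induced_countable U)
    (fun R => [set x | rel_in R (map val x)])
    (fun F x => [set u | fun_in F (map val x) (\val u)])
    (@induced_rel_size L A U) (@induced_fun_size L A U).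

Definition inclusion (L : language) (A : structure L) (U : set A) :
    smap (induced U) A :=
  @SMap L (induced U) A (lmap_id L) val.

Definition inclusion_sub (L : language) (A : structure L) (U V : set A)
    (UV : U `<=` V) : smap (induced U) (induced V) :=
  @SMap L (induced U) (induced V) (lmap_id L)
    (fun u => SigSub (mem_set (UV _ (set_mem (valP u))))).

(* [induced U] is defined for every set [U] of vertices, but it is a
   substructure only if the functions of A do not lead out of [U].  The
   structure on a substructure is determined by its set of vertices. *)
Definition is_sub (L : language) (G : lperm_group L) (A : structure L)
    (U : set A) : Prop :=
  is_emb G (inclusion U).

Definition image_structure (L : language) (A B : structure L) (f : smap A B) :
    structure L :=
  induced (range f).

Definition is_amalgam (L : language) (G : lperm_group L)
    (A B1 B2 : structure L) (a1 : smap A B1) (a2 : smap A B2)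
    (C : structure L) (b1 : smap B1 C) (b2 : smap B2 C) : Prop :=
  [/\ is_emb G b1, is_emb G b2 & smap_comp b1 a1 = smap_comp b2 a2].

Definition is_strong_amalgam (L : language) (G : lperm_group L)
    (A B1 B2 : structure L) (a1 : smap A B1) (a2 : smap A B2)
    (C : structure L) (b1 : smap B1 C) (b2 : smap B2 C) : Prop :=
  is_amalgam G a1 a2 b1 b2 /\
  range b1 `&` range b2 = range (smap_comp b1 a1).

Definition is_free_amalgam (L : language) (G : lperm_group L)
    (A B1 B2 : structure L) (a1 : smap A B1) (a2 : smap A B2)
    (C : structure L) (b1 : smap B1 C) (b2 : smap B2 C) : Prop :=
  [/\ is_strong_amalgam G a1 a2 b1 b2,
      range b1 `|` range b2 = [set: C]
    & forall x : seq C,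
        (exists2 y, List.In y x & (b1 @` (~` range a1)) y) ->
        (exists2 y, List.In y x & (b2 @` (~` range a2)) y) ->
        (forall R, ~ rel_in R x) /\ (forall F, fun_in F x = set0)].

Definition irreducible (L : language) (G : lperm_group L) (A : structure L) :
    Prop :=
  ~ exists (U1 U2 U0 : set A) (U01 : U0 `<=` U1) (U02 : U0 `<=` U2),
      [/\ is_sub G U1 /\ U1 <> [set: A],
          is_sub G U2 /\ U2 <> [set: A],
          is_sub G U0
        & is_free_amalgam G (inclusion_sub U01) (inclusion_sub U02)
            (inclusion U1) (inclusion U2)].

Definition is_hom_emb (L : language) (G : lperm_group L) (A B : structure L)
    (f : smap A B) : Prop :=
  is_hom G f /\
  forall U : set A, is_sub G U -> irreducible G (induced U) ->
    is_emb G (smap_comp f (inclusion U)).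

Definition hereditary (L : language) (G : lperm_group L)
    (K : structure L -> Prop) : Prop :=
  forall (A B : structure L) (f : smap A B), K B -> is_emb G f -> K A.

Definition strong_amalgamation_property (L : language) (G : lperm_group L)
    (K : structure L -> Prop) : Prop :=
  forall (A B1 B2 : structure L) (a1 : smap A B1) (a2 : smap A B2),
    K A -> K B1 -> K B2 -> is_emb G a1 -> is_emb G a2 ->
    exists (C : structure L) (b1 : smap B1 C) (b2 : smap B2 C),
      K C /\ is_strong_amalgam G a1 a2 b1 b2.

Definition completion (L : language) (G : lperm_group L)
    (C C' : structure L) : Prop :=
  irreducible G C' /\ exists f : smap C C', is_hom_emb G f.

Definition aut_preserving_completion (L : language) (G : lperm_group L)
    (C C' : structure L) : Prop :=
  irreducible G C' /\
  exists f : smap C C',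
    [/\ is_hom_emb G f, injective f
      & exists h : smap C C -> smap C' C',
          (forall a, is_aut G a ->
             is_aut G (h a) /\ smap_comp (h a) f = smap_comp f a) /\
          (forall a b, is_aut G a -> is_aut G b ->
             h (smap_comp a b) = smap_comp (h a) (h b))].

(* [compl B B'] is the kind of completion that is required of the resulting
   structure B' in K. *)
Definition locally_finite_for (L : language) (G : lperm_group L)
    (compl : structure L -> structure L -> Prop)
    (E K : structure L -> Prop) : Prop :=
  [/\ forall A, K A -> E A,
      forall A, K A -> irreducible G A
    & forall A B0 : structure L, K A -> E B0 ->
      exists n : nat, forall B : structure L, finite_structure B ->
        (forall U : set B, is_sub G U -> irreducible G (induced U) ->
           exists f : smap (induced U) A, is_emb G f) ->
        (exists f : smap B B0, is_hom_emb G f) ->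
        (forall U : set B, is_sub G U -> (U #<= `I_n)%card ->
           exists2 C', K C' & completion G (induced U) C') ->
        exists2 B', K B' & compl B B'].

Definition locally_finite (L : language) (G : lperm_group L)
    (E K : structure L -> Prop) : Prop :=
  locally_finite_for G (completion G) E K.

Definition locally_finite_aut_preserving (L : language) (G : lperm_group L)
    (E K : structure L -> Prop) : Prop :=
  locally_finite_for G (aut_preserving_completion G) E K.

(* A partial automorphism with domain U and range V. *)
Definition is_partial_aut (L : language) (G : lperm_group L) (A : structure L)
    (U V : set A) (f : smap (induced U) (induced V)) : Prop :=
  [/\ is_sub G U, is_sub G V & is_iso G f].

Definition extends_in (L : language) (A B : structure L) (psi : smap A B)
    (U V : set (image_structure psi)) (f : smap (induced U) (induced V))
    (theta : smap B B) : Prop :=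
  lpart theta = lpart f /\
  forall u : induced U, theta (\val (\val u)) = \val (\val (f u)).

Definition EPPA_witness (L : language) (G : lperm_group L)
    (A B : structure L) : Prop :=
  [/\ finite_structure A, finite_structure B
    & exists2 psi : smap A B, is_emb G psi &
        forall (U V : set (image_structure psi))
               (f : smap (induced U) (induced V)),
          is_partial_aut G f ->
          exists2 theta : smap B B, is_aut G theta & extends_in f theta].

(* As partial automorphisms are onto, range(f) = dom(g) is expressed by
   letting [f] and [g] share the set [V]. *)
Definition coherent_EPPA_witness (L : language) (G : lperm_group L)
    (A B : structure L) : Prop :=
  [/\ finite_structure A, finite_structure B
    & exists2 psi : smap A B, is_emb G psi &
        exists hat : forall U V : set (image_structure psi),
            smap (induced U) (induced V) -> smap B B,
          (forall U V (f : smap (induced U) (induced V)),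
             is_partial_aut G f ->
             is_aut G (hat U V f) /\ extends_in f (hat U V f)) /\
          (forall U V W (f : smap (induced U) (induced V))
                        (g : smap (induced V) (induced W)),
             is_partial_aut G f -> is_partial_aut G g ->
             hat U W (smap_comp g f) = smap_comp (hat V W g) (hat U V f))].

Definition has_EPPA (L : language) (G : lperm_group L)
    (K : structure L -> Prop) : Prop :=
  forall A, K A -> exists2 B, K B & EPPA_witness G A B.

Definition has_coherent_EPPA (L : language) (G : lperm_group L)
    (K : structure L -> Prop) : Prop :=
  forall A, K A -> exists2 B, K B & coherent_EPPA_witness G A B.

(* Main.v *)
From HB Require Import structures.
Require Import Defs.
From mathcomp Require Import all_boot all_fingroup.
From mathcomp Require Import all_classical.

(** Let [A] be in [K] and let [B0] be an EPPA-witness for [A] in [E].  The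
witness in [K] is obtained by completing a finite structure [B] that projects to
[B0], that is still an EPPA-witness for [A], and that is glued from copies of
[A] in a tree-like way as far as bounded sets of vertices can see.  Local
finiteness completes [B] inside [K]; since the completion preserves
automorphisms functorially, it inherits the (coherent) extension property.

The construction of [B] is a statement about hypergraphs.  The copies of [A] in
[B0] are the edges of a hypergraph on which chosen extensions of the partial
automorphisms of [A] act; a [system] records this, together with the closure
operator generated by the unary functions.  One covering operation is iterated.
A [pattern] says which pairs of vertices should get equal labels; it is
realizable if every edge can be labelled accordingly.  The cover [step] attaches
to each vertex a labelling of its closure for every realizable pattern, and lifts
an edge once for each labelling of it.  Three facts make this work:
- every realizable pattern acquires a global labelling on the cover
  ([step_realizes]), so a configuration whose pattern has local but no global
  labellings is destroyed;
- a set whose pairs lie in common edges and whose image lies in an edge lies in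
  an edge ([step_lift]), so nothing that was achieved is lost;
- the symmetries lift, coherently ([step_comp]), because partial bijections of
  label sets have canonical extensions to permutations ([extend_comp]).

With injective labels from a set of size [k], a clique of size [k + 1] that is
not contained in an edge is destroyed; after finitely many rounds all cliques are
contained in edges ([conformal_cover]).  With two labels, every graph cycle that
obstructs a decomposition along cliques is destroyed: if each realizable
two-label pattern is realized globally on a set, then minimal separators of that
set are cliques ([clique_separator]).  A small set is in this situation at some
stage of the iteration, since every unsuccessful stage increases its number of
nonadjacent pairs ([treelike_cover]).

Cutting along clique separators, which are closed and lie in copies of [A],
amalgamation in [K] maps every small substructure of [B] to a member of [K]
([completable_trivializes]).  Irreducible structures cannot be cut at all, so
irreducible substructures of [B] lie in copies of [A] ([irreducible_clique]),
and maps that are embeddings on cliques are homomorphism-embeddings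
([clique_emb_hom_emb]).  These are the conditions of local finiteness. *)

Set Implicit Arguments.
Unset Strict Implicit.
Unset Printing Implicit Defensive.

(** * Canonical extension of partial bijections *)

Section CanonicalExtension.
Variable S : finType.
Implicit Types g : {set S * S}.

(** The graph of a bijection between two subsets of [S]; both implications
are packed into one boolean equality. *)
Definition partial_bij g : Prop :=
  forall s t s' t', (s, t) \in g -> (s', t') \in g -> (s == s') = (t == t').

Definition gdom g : {set S} := [set st.1 | st in g].
Definition grng g : {set S} := [set st.2 | st in g].

(** Outside its domain, a partial bijection is continued by the increasing
bijection between the complements of domain and range (with respect to [enum]).
This choice, unlike an arbitrary one, is compatible with composition.  The
default value of [nth] is never used when [g] is a partial bijection. *)
Definition extend g (s : S) : S :=
  if [pick t | (s, t) \in g] is Some t then t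
  else nth s (enum (~: grng g)) (index s (enum (~: gdom g))).

Lemma gdomP g s : reflect (exists t, (s, t) \in g) (s \in gdom g).
Proof.
apply: (iffP imsetP) => [[[s' t] /= st ->]|[t st]]; first by exists t.
by exists (s, t).
Qed.

Lemma grngP g t : reflect (exists s, (s, t) \in g) (t \in grng g).
Proof.
apply: (iffP imsetP) => [[[s t'] /= st ->]|[s st]]; first by exists s.
by exists (s, t).
Qed.

Lemma extend_in g s t : partial_bij g -> (s, t) \in g -> extend g s = t.
Proof.
move=> pb st; rewrite /extend; case: pickP => [t' st'|/(_ t)]; last by rewrite st.
by apply/eqP; rewrite -(pb _ _ _ _ st' st).
Qed.

Lemma extend_out g s : s \notin gdom g ->
  extend g s = nth s (enum (~: grng g)) (index s (enum (~: gdom g))).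
Proof.
by move=> /gdomP sg; rewrite /extend; case: pickP => // t st; case: sg; exists t.
Qed.

Lemma card_grng g : partial_bij g -> #|grng g| = #|gdom g|.
Proof.
move=> pb; rewrite !card_in_imset// => -[s t] [s' t'] st st' /= e;
  have := pb _ _ _ _ st st'; rewrite e eqxx; first by move=> /esym/eqP ->.
by move/eqP ->.
Qed.

Lemma size_compl g : partial_bij g ->
  size (enum (~: grng g)) = size (enum (~: gdom g)).
Proof.
by move=> pb; rewrite -!cardE; apply/eqP; rewrite -(eqn_add2l #|grng g|) cardsC
  card_grng// cardsC.
Qed.

Lemma extend_compl g s : partial_bij g -> s \notin gdom g ->
  [/\ extend g s \notin grng g, index s (enum (~: gdom g)) < size (enum (~: grng g))
    & index (extend g s) (enum (~: grng g)) = index s (enum (~: gdom g))].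
Proof.
move=> pb sg.
have lt : index s (enum (~: gdom g)) < size (enum (~: grng g)).
  by rewrite size_compl// index_mem mem_enum inE.
split=> //; last by rewrite extend_out// index_uniq// enum_uniq.
have := mem_nth s lt; rewrite mem_enum inE => h.
by rewrite extend_out.
Qed.

Lemma extend_inj g : partial_bij g -> injective (extend g).
Proof.
move=> pb s s'.
have inr u : u \in gdom g -> extend g u \in grng g.
  by case/gdomP=> t ut; rewrite (extend_in pb ut); apply/grngP; exists u.
case: (boolP (s \in gdom g)) (boolP (s' \in gdom g)) => sg [] s'g e.
- case/gdomP: sg e => t st; case/gdomP: s'g => t' st'.
  rewrite (extend_in pb st) (extend_in pb st') => /eqP.
  by rewrite -(pb _ _ _ _ st st') => /eqP.
- by case: (extend_compl pb s'g); rewrite -e inr.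
- by case: (extend_compl pb sg); rewrite e inr.
case: (extend_compl pb sg) => _ _ i; case: (extend_compl pb s'g) => _ _.
rewrite -e i; move=> /(congr1 (nth s (enum (~: gdom g)))).
by rewrite !nth_index // mem_enum inE.
Qed.

(** Increasing bijections compose to increasing bijections; this is the source
of coherence. *)
Lemma extend_comp g1 g2 g3 :
    partial_bij g1 -> partial_bij g2 -> partial_bij g3 ->
    gdom g3 = gdom g1 -> grng g1 = gdom g2 -> grng g3 = grng g2 ->
    (forall s t u, (s, t) \in g1 -> (t, u) \in g2 -> (s, u) \in g3) ->
  forall s, extend g3 s = extend g2 (extend g1 s).
Proof.
move=> pb1 pb2 pb3 d31 r12 r32 component s.
case: (boolP (s \in gdom g1)) => sg.
  have [t st] := gdomP _ _ sg.
  have : t \in gdom g2 by rewrite -r12; apply/grngP; exists s.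
  case/gdomP=> u tu.
  by rewrite (extend_in pb1 st) (extend_in pb2 tu) (extend_in pb3 (component _ _ _ st tu)).
have [n1 l1 i1] := extend_compl pb1 sg.
have n2 : extend g1 s \notin gdom g2 by rewrite -r12.
have sg3 : s \notin gdom g3 by rewrite d31.
rewrite extend_out // (extend_out n2) -r12 i1 r32 d31.
by apply: set_nth_default; rewrite size_compl// -r12.
Qed.

End CanonicalExtension.

(** * Hypergraphs of copies with partial symmetries, and their covers *)

Section Systems.
Variables (A P : Type) (dom : P -> A -> Prop) (ap : P -> A -> A).

(** The edges are the copies of [A]; [base] is a distinguished copy; [act p]
is the chosen total extension of the partial map [p] of [A].  Vertices outside
all edges occur in covers; there [cl] is not reflexive.  The last field says that
domains of partial maps are closed. *)
Record system := System {
  point :> finType;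
  edges : {set {set point}};
  cl : point -> {set point};
  base : A -> point;
  act : P -> {perm point};
  cl_refl : forall C x, C \in edges -> x \in C -> x \in cl x;
  cl_trans : forall x y, y \in cl x -> cl y \subset cl x;
  edge_cl : forall C x, C \in edges -> x \in C -> cl x \subset C;
  base_edge : exists2 C, C \in edges & forall a, base a \in C;
  act_edge : forall p C, C \in edges -> act p @: C \in edges;
  act_cl : forall p x, cl (act p x) = act p @: cl x;
  act_base : forall p a, dom p a -> act p (base a) = base (ap p a);
  cl_base : forall p a x, dom p a -> x \in cl (base a) ->
    exists2 b, dom p b & x = base b }.

(** Not reflexive: [adj x x] means that [x] lies in some edge. *)
Definition adj (X : system) (x y : X) : bool :=
  [exists C in edges X, (x \in C) && (y \in C)].

Definition clique (X : system) (M : {set X}) : bool :=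
  [forall x in M, forall y in M, adj x y].

Definition closed (X : system) (M : {set X}) : bool :=
  [forall x in M, cl x \subset M].

Definition face (X : system) (M : {set X}) : bool :=
  [exists C in edges X, M \subset C].

Definition conformal (X : system) : Prop :=
  forall M : {set X}, clique M -> face M.

Definition conformal_upto (k : nat) (X : system) : Prop :=
  forall M : {set X}, clique M -> #|M| <= k -> face M.

(** The field [cover_lift] is a strong form of local lifting: being in a
common edge is decided pairwise once the image is known to be in an edge.  The
field [cover_comp] transports coherence for one triple [r = q p] at a time, so
that plain and coherent extension properties are handled together. *)
Record is_cover (X Y : system) (f : X -> Y) : Prop := IsCover {
  cover_edge : forall C, C \in edges X -> f @: C \in edges Y;
  cover_inj : forall C, C \in edges X -> {in C &, injective f};
  cover_lift : forall M : {set X}, clique M -> face (f @: M) -> face M;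
  cover_cl : forall x, f @: cl x = cl (f x);
  cover_base : forall a, f (base X a) = base Y a;
  cover_act : forall p x, f (act X p x) = act Y p (f x);
  cover_comp : forall p q r,
    (forall a, dom r a <-> dom p a) ->
    (forall b, dom q b <-> exists2 a, dom p a & ap p a = b) ->
    (forall a, dom p a -> ap r a = ap q (ap p a)) ->
    (forall y, act Y r y = act Y q (act Y p y)) ->
    forall x, act X r x = act X q (act X p x) }.

Lemma adjP (X : system) (x y : X) :
  reflect (exists C, [/\ C \in edges X, x \in C & y \in C]) (adj x y).
Proof.
apply: (iffP exists_inP) => [[C CX /andP[xC yC]]|[C [CX xC yC]]]; exists C => //.
by rewrite xC.
Qed.

Lemma faceP (X : system) (M : {set X}) :
  reflect (exists2 C, C \in edges X & M \subset C) (face M).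
Proof. exact: exists_inP. Qed.

Lemma cliqueP (X : system) (M : {set X}) :
  reflect {in M &, forall x y, adj x y} (clique M).
Proof.
apply: (iffP forall_inP) => [h x y xM yM|h x xM]; last by apply/forall_inP => y yM; apply: h.
by have /forall_inP := h x xM; apply.
Qed.

Lemma closedP (X : system) (M : {set X}) :
  reflect {in M, forall x, cl x \subset M} (closed M).
Proof. exact: forall_inP. Qed.

Lemma adj_sym (X : system) (x y : X) : adj x y = adj y x.
Proof. by apply/adjP/adjP => -[C [CX xC yC]]; exists C. Qed.

Lemma face_clique (X : system) (M : {set X}) : face M -> clique M.
Proof.
move=> /faceP[C CX /fintype.subsetP MC]; apply/cliqueP => x y /MC xC /MC yC.
by apply/adjP; exists C.
Qed.

Lemma adj_refll (X : system) (x y : X) : adj x y -> adj x x.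
Proof. by move=> /adjP[C [CX xC _]]; apply/adjP; exists C. Qed.

(** An edge is closed, so it contains [z] as soon as it contains [y]. *)
Lemma adj_cl (X : system) (x y z : X) : adj x y -> z \in cl y -> adj x z.
Proof.
move=> /adjP[C [CX xC yC]] zy; apply/adjP; exists C; split=> //.
exact: (fintype.subsetP (edge_cl CX yC)).
Qed.

Lemma cl_refl_adj (X : system) (x : X) : adj x x -> x \in cl x.
Proof. by move=> /adjP[C [CX xC _]]; exact: cl_refl CX xC. Qed.

(** A permutation that maps a finite family of sets into itself permutes it. *)
Lemma act_edge_iff (X : system) p (C : {set X}) :
  (act X p @: C \in edges X) = (C \in edges X).
Proof.
apply/idP/idP; last exact: act_edge.
set f := fun C : {set X} => act X p @: C.
have fI : injective f by apply: imset_inj; apply: perm_inj.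
have /eqP e : f @: edges X == edges X.
  rewrite eqEcard card_imset// leqnn andbT.
  by apply/fintype.subsetP => _ /imsetP[D DX ->]; apply: act_edge.
by rewrite -[in X in X -> _]e => /imsetP[D DX /fI->].
Qed.

Lemma act_preimset_edge (X : system) p (C : {set X}) :
  C \in edges X -> act X p @^-1: C \in edges X.
Proof.
rewrite -[act X p @^-1: C \in _](act_edge_iff p) (_ : act X p @: _ = C)//; apply/setP => x.
by rewrite -[x](permKV (act X p)) mem_imset ?inE//; exact: perm_inj.
Qed.

Section Cover.
Variables (X Y : system) (f : X -> Y).
Hypothesis fc : is_cover f.

Lemma cover_adj x y : adj x y -> adj (f x) (f y).
Proof.
move=> /adjP[C [CX xC yC]]; apply/adjP; exists (f @: C).
by rewrite !imset_f// (cover_edge fc).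
Qed.

Lemma cover_adj_inj x y : adj x y -> f x = f y -> x = y.
Proof. by move=> /adjP[C [CX xC yC]]; apply: (cover_inj fc CX). Qed.

Lemma cover_clique (M : {set X}) : clique M -> clique (f @: M).
Proof.
move=> /cliqueP cM; apply/cliqueP => _ _ /imsetP[x xM ->] /imsetP[y yM ->].
exact/cover_adj/cM.
Qed.

Lemma cover_clique_inj (M : {set X}) : clique M -> {in M &, injective f}.
Proof. by move=> /cliqueP cM x y xM yM; apply/cover_adj_inj/cM. Qed.

Lemma cover_closed (M : {set X}) : closed M -> closed (f @: M).
Proof.
move=> /closedP cM; apply/closedP => _ /imsetP[x xM ->].
by rewrite -(cover_cl fc) imsetS// cM.
Qed.

Lemma cover_conformal : conformal Y -> conformal X.
Proof. by move=> cY M cM; apply/(cover_lift fc)/cY/cover_clique. Qed.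

End Cover.

Lemma cover_id (X : system) : is_cover (@id X).
Proof.
by split=> [C|C _|M _|x|a|p x|p q r _ _ _]; rewrite ?imset_id// => ? ?.
Qed.

Lemma cover_trans (X Y Z : system) (f : X -> Y) (g : Y -> Z) :
  is_cover f -> is_cover g -> is_cover (g \o f).
Proof.
move=> fc gc; split=> [C CX|C CX x y xC yC /= e|M cM|x|a|p x|p q r h1 h2 h3 h4].
- by rewrite imset_comp (cover_edge gc)// (cover_edge fc).
- apply: (cover_inj fc CX) => //.
  by apply: (cover_inj gc (cover_edge fc CX)); rewrite ?imset_f.
- rewrite imset_comp => /(cover_lift gc) h.
  by apply: (cover_lift fc cM); apply: h; exact: (cover_clique fc).
- by rewrite imset_comp (cover_cl fc) (cover_cl gc).
- by rewrite /= (cover_base fc) (cover_base gc).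
- by rewrite /= (cover_act fc) (cover_act gc).
- by apply: (cover_comp fc) => //; exact: (cover_comp gc).
Qed.

End Systems.

(** * The cover by labellings *)

Section Labelings.
Variables (T S : finType).
Implicit Types (w : {set T * T}) (D : {set T}).

(** The pattern [w] prescribes both the support of the labelling (the
diagonal of [w]) and the pairs of supported points with equal labels. *)
Definition realizes w D (l : T -> option S) : Prop :=
  forall x y, x \in D -> y \in D -> ((x, y) \in w) = (l x == l y) && isSome (l x).

Lemma realizes_sub w D D' l : D' \subset D -> realizes w D l -> realizes w D' l.
Proof. by move=> /fintype.subsetP s h x y /s xD /s yD; apply: h. Qed.

Lemma realizes_eq w D (l l' : T -> option S) :
  {in D, l =1 l'} -> realizes w D l -> realizes w D l'.
Proof. by move=> e h x y xD yD; rewrite -!e//; exact: h. Qed.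

Lemma realizes_omap w D l (f : S -> S) : injective f ->
  realizes w D l -> realizes w D (omap f \o l).
Proof.
move=> fI h x y xD yD; rewrite h//=; case: (l x) (l y) => [s|] [t|] //=.
by rewrite !andbT; apply/eqP/eqP => [[->]//|[/fI->]].
Qed.

(** The correspondence between two partial labellings of the same index set.
Only the pairs of labels matter, not the indices; this makes coherence
independent of how the domain of a partial map is parametrized. *)
Definition matching (I : Type) (D : I -> Prop) (u v : I -> option S) : {set S * S} :=
  [set st | `[< exists i, [/\ D i, u i = Some st.1 & v i = Some st.2] >]].

Lemma matchingP (I : Type) (D : I -> Prop) (u v : I -> option S) s t :
  reflect (exists i, [/\ D i, u i = Some s & v i = Some t])
    ((s, t) \in matching D u v).
Proof. by rewrite inE; apply: asboolP. Qed.

Definition same_pattern (I : Type) (D : I -> Prop) (u v : I -> option S) : Prop :=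
  forall i j, D i -> D j ->
    (u i == u j) && isSome (u i) = (v i == v j) && isSome (v i).

Lemma same_pattern_isSome (I : Type) (D : I -> Prop) (u v : I -> option S) i :
  same_pattern D u v -> D i -> isSome (u i) = isSome (v i).
Proof. by move=> h Di; have := h i i Di Di; rewrite !eqxx. Qed.

Lemma partial_bij_matching (I : Type) (D : I -> Prop) (u v : I -> option S) :
  same_pattern D u v -> partial_bij (matching D u v).
Proof.
move=> h s t s' t' /matchingP[i [Di us vt]] /matchingP[j [Dj us' vt']].
have := h i j Di Dj; rewrite us us' vt vt' /= !andbT.
exact.
Qed.

Lemma omap_extend_matching (I : Type) (D : I -> Prop) (u v : I -> option S) i :
  same_pattern D u v -> D i -> omap (extend (matching D u v)) (u i) = v i.
Proof.
move=> h Di; have := same_pattern_isSome h Di.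
case us: (u i) => [s|]; case vt: (v i) => [t|] //= _; congr Some.
by apply: extend_in; [exact: partial_bij_matching|apply/matchingP; exists i].
Qed.

Lemma realizes_same_pattern w D l l' : realizes w D l -> realizes w D l' ->
  same_pattern (fun x => x \in D) l l'.
Proof. by move=> h h' i j iD jD; rewrite -h// -h'. Qed.

(** Two labellings realizing the same pattern differ by a partial bijection
of labels.  Extended to a permutation and applied to a labelling of [C], it makes
that labelling agree with the given one of [D]. *)
Lemma realizes_extend w D (C : {set T}) l l' :
    D \subset C -> realizes w D l -> realizes w C l' ->
  exists2 l'', realizes w C l'' & {in D, l'' =1 l}.
Proof.
move=> DC lD lC.
have sp := realizes_same_pattern (realizes_sub DC lC) lD.
exists (omap (extend (matching (fun x => x \in D) l' l)) \o l').
  by apply: realizes_omap => //; apply/extend_inj/partial_bij_matching.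
by move=> x xD /=; rewrite omap_extend_matching.
Qed.

End Labelings.

Section Step.
Variables (A P : Type) (dom : P -> A -> Prop) (ap : P -> A -> A).
Variables (X : system dom ap) (S : finType).

Notation pattern := {set X * X}.
Notation labeling := {ffun X * {set X * X} -> option S}.

Implicit Types (w : pattern) (l : labeling) (C : {set X}).

Definition realizable w : Prop :=
  forall C, C \in edges X -> exists l : X -> option S, realizes w C l.

(** Replacing unrealizable patterns by the empty one, which forces the
labels [None], avoids a subtype of realizable patterns. *)
Definition effective w : pattern := if `[< realizable w >] then w else finset.set0.

Definition compatible C l : Prop :=
  forall w, realizes (effective w) C (fun x => l (x, w)).

(** A vertex of the cover is a vertex [x] with a labelling of its whole
closure, not only of [x]: the closure of [x] must have a unique lift, so that the
unary functions can be lifted. *)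
Definition restrict (x : X) l : labeling :=
  [ffun yw => if yw.1 \in cl x then l yw else None].

Lemma restrict_restr x y l : y \in cl x -> restrict y (restrict x l) = restrict y l.
Proof.
move=> yx; apply/ffunP => -[z w]; rewrite !ffunE /=; case: ifP => // zy.
by rewrite (fintype.subsetP (cl_trans yx)).
Qed.

Lemma effective_exists w C : C \in edges X ->
  exists l : X -> option S, realizes (effective w) C l.
Proof.
rewrite /effective; case: asboolP => [r CX|_ _]; first exact: r.
by exists (fun=> None) => x y _ _; rewrite inE andbF.
Qed.

Lemma compatible_exists C (D : {set X}) (l0 : labeling) : C \in edges X -> D \subset C ->
  compatible D l0 -> exists2 l, compatible C l & {in D, forall x w, l (x, w) = l0 (x, w)}.
Proof.
move=> CX DC l0D.
have /choice[f hf] w : exists l : X -> option S,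
    realizes (effective w) C l /\ {in D, forall x, l x = l0 (x, w)}.
  have [l' lC] := effective_exists w CX.
  by have [l l1 l2] := realizes_extend DC (l0D w) lC; exists l.
exists [ffun yw => f yw.2 yw.1].
  by move=> w; apply: (realizes_eq _ (hf w).1) => x _ /=; rewrite ffunE.
by move=> x xD w; rewrite ffunE; apply: (hf w).2.
Qed.

Definition lift_edge (C : {set X}) l : {set X * labeling} := [set (x, restrict x l) | x in C].

Definition step_edges : {set {set X * labeling}} :=
  [set C' | `[< exists C l, [/\ C \in edges X, compatible C l & C' = lift_edge C l] >]].

Lemma step_edgesP (C' : {set X * labeling}) :
  reflect (exists C l, [/\ C \in edges X, compatible C l & C' = lift_edge C l])
    (C' \in step_edges).
Proof. by rewrite inE; apply: asboolP. Qed.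

Definition step_cl (v : X * labeling) : {set X * labeling} := lift_edge (cl v.1) v.2.

Lemma lift_edgeP C l v : reflect (v.1 \in C /\ v.2 = restrict v.1 l) (v \in lift_edge C l).
Proof.
apply: (iffP imsetP) => [[x xC ->]|[vC e]] //; exists v.1 => //.
by rewrite -e; case: (v).
Qed.

Lemma base_labeling : exists l0 : labeling,
  exists2 C, C \in edges X & (forall a, base X a \in C) /\ compatible C l0.
Proof.
have [C CX bC] := base_edge X.
have [||l lC _] := @compatible_exists C finset.set0 [ffun=> None] CX.
- exact: finset.sub0set.
- by move=> w x y; rewrite inE.
- by exists l, C.
Qed.

(** An arbitrary labelling of the base edge; its lift is the base edge of
the cover. *)
Definition label0 : labeling := projT1 (cid base_labeling).

Lemma label0P : exists2 C, C \in edges X & (forall a, base X a \in C) /\ compatible C label0.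
Proof. exact: projT2 (cid base_labeling). Qed.

Definition step_base (a : A) : X * labeling := (base X a, restrict (base X a) label0).

(** Permutations act on patterns by preimages, which is contravariant:
labels for the pattern [w] after the action come from labels for [pull p w]
before it. *)
Definition pull (p : P) w : pattern := [set xy | (act X p xy.1, act X p xy.2) \in w].

Lemma realizable_pull p w : realizable (pull p w) <-> realizable w.
Proof.
split=> r C CX.
  have [l lD] := r _ (act_preimset_edge p CX).
  exists (fun x => l ((act X p)^-1%g x)) => x y xC yC.
  by rewrite -lD ?inE ?permKV//=.
have [|l lC] := r (act X p @: C); first by rewrite act_edge_iff.
exists (fun x => l (act X p x)) => x y xC yC.
by rewrite inE /= lC ?imset_f.
Qed.

Lemma effective_pull p w : effective (pull p w) = pull p (effective w).
Proof.
rewrite /effective (propext (realizable_pull p w)); case: asboolP => // _.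
by apply/setP => xy; rewrite !inE.
Qed.

Definition label_matching p w : {set S * S} :=
  matching (dom p) (fun a => label0 (base X a, pull p w))
    (fun a => label0 (base X (ap p a), w)).

(** The action must map the labelling [label0] of the base edge to itself
along the partial map [p].  This prescribes, for each pattern, a partial bijection
of labels, of which the canonical extension is applied. *)
Definition act_label p l : labeling :=
  [ffun yw => omap (extend (label_matching p yw.2)) (l ((act X p)^-1%g yw.1, pull p yw.2))].

Lemma label_matching_pattern p w : same_pattern (dom p)
  (fun a => label0 (base X a, pull p w)) (fun a => label0 (base X (ap p a), w)).
Proof.
have [C CX [bC lC]] := label0P => a b da db.
rewrite -(lC (pull p w)) ?bC// -(lC w) ?bC//.
by rewrite effective_pull inE /= !act_base.
Qed.

Lemma label_matching_bij p w : partial_bij (label_matching p w).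
Proof. exact/partial_bij_matching/label_matching_pattern. Qed.

Lemma act_labelE p l x w :
  act_label p l (act X p x, w) = omap (extend (label_matching p w)) (l (x, pull p w)).
Proof. by rewrite ffunE /= permK. Qed.

(** The base labels at [p a], transported back along [act p], have the same
equality pattern as those at [a], since [act p] maps [base a] to [base (p a)]. *)
Lemma act_label_base p a w : dom p a ->
  act_label p label0 (base X (ap p a), w) = label0 (base X (ap p a), w).
Proof.
move=> da; rewrite -(act_base X da) act_labelE act_base//.
exact: (omap_extend_matching (@label_matching_pattern p w) da).
Qed.

Lemma pull_inj p : injective (pull p).
Proof.
move=> w w' e; apply/setP => -[x y].
have /setP/(_ ((act X p)^-1%g x, (act X p)^-1%g y)) := e.
by rewrite !inE /= !permKV.
Qed.

Lemma act_label_inj p : injective (act_label p).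
Proof.
move=> l l' e; apply/ffunP => -[x w].
have [u pu uK] : bijective (pull p) by apply: injF_bij; exact: pull_inj.
have /ffunP/(_ (act X p x, u w)) := e; rewrite !act_labelE uK.
by case: (l _) (l' _) => [s|] [s'|] //= [/(extend_inj (@label_matching_bij p _))->].
Qed.

Lemma act_label_compatible p C l :
  compatible C l -> compatible (act X p @: C) (act_label p l).
Proof.
move=> lC w _ _ /imsetP[x xC ->] /imsetP[y yC ->].
have := realizes_omap (extend_inj (@label_matching_bij p w)) (lC (pull p w)) xC yC.
by rewrite effective_pull inE /= => ->; rewrite !act_labelE.
Qed.

Lemma restrict_act p x l : restrict (act X p x) (act_label p l) = act_label p (restrict x l).
Proof.
apply/ffunP => -[y' w].
have [y ->] : exists y, y' = act X p y by exists ((act X p)^-1%g y'); rewrite permKV.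
rewrite ffunE !act_labelE /= ffunE /= act_cl mem_imset; last exact: perm_inj.
by case: ifP.
Qed.

Definition step_act_fun p (v : X * labeling) : X * labeling :=
  (act X p v.1, act_label p v.2).

Lemma step_act_inj p : injective (step_act_fun p).
Proof. by move=> [x l] [y l'] [/perm_inj -> /act_label_inj ->]. Qed.

Definition step_act p : {perm X * labeling} := perm (@step_act_inj p).

Lemma step_actE p v : step_act p v = (act X p v.1, act_label p v.2).
Proof. by rewrite permE. Qed.

Lemma step_act_lift_edge p C l :
  step_act p @: lift_edge C l = lift_edge (act X p @: C) (act_label p l).
Proof.
rewrite /lift_edge -!imset_comp; apply: eq_imset => x /=.
by rewrite step_actE /= restrict_act.
Qed.

Lemma step_cl_refl (C : {set X * labeling}) v :
  C \in step_edges -> v \in C -> v \in step_cl v.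
Proof.
move=> /step_edgesP[D [l [DX _ ->]]] /lift_edgeP[vD e]; apply/lift_edgeP.
have vv := cl_refl DX vD; split=> //.
by rewrite e restrict_restr.
Qed.

Lemma step_cl_trans v u : u \in step_cl v -> step_cl u \subset step_cl v.
Proof.
move=> /lift_edgeP[uv e]; apply/fintype.subsetP => t /lift_edgeP[tu e']; apply/lift_edgeP.
split; first exact: (fintype.subsetP (cl_trans uv)).
by rewrite e' e restrict_restr.
Qed.

Lemma step_edge_cl (C : {set X * labeling}) v :
  C \in step_edges -> v \in C -> step_cl v \subset C.
Proof.
move=> /step_edgesP[D [l [DX _ ->]]] /lift_edgeP[vD e].
apply/fintype.subsetP => t /lift_edgeP[tv e']; apply/lift_edgeP.
split; first exact: (fintype.subsetP (edge_cl DX vD)).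
by rewrite e' e restrict_restr.
Qed.

Lemma step_base_edge : exists2 C, C \in step_edges & forall a, step_base a \in C.
Proof.
have [C CX [bC lC]] := label0P; exists (lift_edge C label0).
  by apply/step_edgesP; exists C, label0.
by move=> a; apply/lift_edgeP; split => /=.
Qed.

Lemma step_act_edge p (C : {set X * labeling}) :
  C \in step_edges -> step_act p @: C \in step_edges.
Proof.
move=> /step_edgesP[D [l [DX lD ->]]]; rewrite step_act_lift_edge; apply/step_edgesP.
exists (act X p @: D), (act_label p l); split=> //; first exact: act_edge.
exact: act_label_compatible.
Qed.

Lemma step_act_cl p v : step_cl (step_act p v) = step_act p @: step_cl v.
Proof. by rewrite step_act_lift_edge /step_cl step_actE /= act_cl. Qed.

Lemma step_act_base p a : dom p a -> step_act p (step_base a) = step_base (ap p a).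
Proof.
move=> da; rewrite step_actE /= -restrict_act act_base//; congr (_, _).
apply/ffunP => -[y w]; rewrite !ffunE /=; case: ifP => //.
rewrite -act_base// act_cl => /imsetP[x xa ->].
have [b db ->] := cl_base da xa.
have := act_label_base w db; rewrite -(act_base X db) act_labelE permK => {1}->.
by [].
Qed.

Lemma step_cl_base p a v : dom p a -> v \in step_cl (step_base a) ->
  exists2 b, dom p b & v = step_base b.
Proof.
move=> da /lift_edgeP[va e].
have [b db vb] := cl_base da va; exists b => //.
rewrite /step_base -vb; case: v va e vb => x l /= xa -> _.
by rewrite restrict_restr.
Qed.

Definition step : system dom ap :=
  System step_cl_refl step_cl_trans step_edge_cl step_base_edge step_act_edge
    step_act_cl step_act_base step_cl_base.

Definition step_proj (v : step) : X := v.1.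

(** Adjacent vertices of the cover carry restrictions of one common
labelling; every local property of the cover comes from this. *)
Lemma step_adj_common (u v : step) : adj u v -> exists C l,
  [/\ C \in edges X, compatible C l, u.1 \in C /\ v.1 \in C,
      u.2 = restrict u.1 l & v.2 = restrict v.1 l].
Proof.
move=> /adjP[_ [/step_edgesP[C [l [CX lC ->]]] /lift_edgeP[uC eu] /lift_edgeP[vC ev]]].
by exists C, l.
Qed.

(** Pairwise adjacency makes the labels carried by the vertices of [M] agree
on common points and makes their union realize every pattern.  This union is then
extended from the closures of the points of [M] to the whole edge [C]. *)
Lemma step_lift (M : {set step}) : clique M -> face (step_proj @: M) -> face M.
Proof.
move=> /cliqueP cM /faceP[C CX /fintype.subsetP MC].
have vC v : v \in M -> v.1 \in C by move=> vM; apply/MC/imset_f.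
pose D := [set y | [exists v in M, y \in cl v.1]].
have DP y : reflect (exists2 v, v \in M & y \in cl v.1) (y \in D).
  by rewrite inE; apply: exists_inP.
have DC : D \subset C.
  apply/fintype.subsetP => y /DP[v vM yv].
  exact: (fintype.subsetP (edge_cl CX (vC v vM))).
pose l : labeling := [ffun yw =>
  if [pick v in M | yw.1 \in cl v.1] is Some v then v.2 yw else None].
have agree u v y w : u \in M -> v \in M -> y \in cl u.1 -> y \in cl v.1 ->
    u.2 (y, w) = v.2 (y, w).
  move=> uM vM yu yv.
  have [E [l' [_ _ _ -> ->]]] := step_adj_common (cM _ _ uM vM).
  by rewrite !ffunE /= yu yv.
have lE v y w : v \in M -> y \in cl v.1 -> l (y, w) = v.2 (y, w).
  move=> vM yv; rewrite ffunE; case: pickP => /=.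
    by move=> u /andP[uM yu]; apply: agree.
  by move=> /(_ v); rewrite vM yv.
have lD : compatible D l.
  move=> w x y /DP[u uM xu] /DP[v vM yv]; rewrite !(lE u x)// !(lE v y)//.
  have [E [l' [EX lE' [uE vE] -> ->]]] := step_adj_common (cM _ _ uM vM).
  rewrite !ffunE /= xu yv; apply: lE'.
    exact: (fintype.subsetP (edge_cl EX uE)).
  exact: (fintype.subsetP (edge_cl EX vE)).
have [l' lC' ll'] := compatible_exists CX DC lD.
apply/faceP; exists (lift_edge C l'); first by apply/step_edgesP; exists C, l'.
apply/fintype.subsetP => v vM; apply/lift_edgeP; split; first exact: vC.
apply/ffunP => -[y w]; rewrite ffunE /=; case: ifPn => [yv|yv].
  by rewrite ll' ?(lE v)//; apply/DP; exists v.
have [E [l'' [_ _ _ -> _]]] := step_adj_common (cM _ _ vM vM).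
by rewrite ffunE /= (negbTE yv).
Qed.

Lemma pull_comp p q r w : (forall y, act X r y = act X q (act X p y)) ->
  pull r w = pull p (pull q w).
Proof. by move=> e; apply/setP => xy; rewrite !inE /= !e. Qed.

(** For each pattern, the three partial bijections of labels compose, so
[extend_comp] applies. *)
Lemma step_comp p q r :
    (forall a, dom r a <-> dom p a) ->
    (forall b, dom q b <-> exists2 a, dom p a & ap p a = b) ->
    (forall a, dom p a -> ap r a = ap q (ap p a)) ->
    (forall y, act X r y = act X q (act X p y)) ->
  forall v, step_act r v = step_act q (step_act p v).
Proof.
move=> dr dq ar e [x l]; rewrite !step_actE /= e; congr (_, _).
apply/ffunP => -[y' w].
have [y ->] : exists y, y' = act X r y by exists ((act X r)^-1%g y'); rewrite permKV.
rewrite act_labelE e !act_labelE (pull_comp w e).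
case: (l _) => //= s; congr Some.
have dqi a : dom p a -> dom q (ap p a) by move=> da; apply/dq; exists a.
apply: extend_comp; try exact: label_matching_bij.
- apply/setP => i; apply/gdomP/gdomP.
    move=> [t /matchingP[a [/dr da]]]; rewrite (pull_comp w e) => h1 _.
    have := same_pattern_isSome (@label_matching_pattern p (pull q w)) da.
    rewrite h1; case h2: (label0 _) => [t'|] // _.
    by exists t'; apply/matchingP; exists a.
  move=> [t /matchingP[a [da h1 _]]].
  have /dr da' := da.
  have := same_pattern_isSome (@label_matching_pattern r w) da'.
  rewrite (pull_comp w e) h1; case h2: (label0 _) => [t'|] // _.
  by exists t'; apply/matchingP; exists a; rewrite (pull_comp w e).
- apply/setP => i; apply/grngP/gdomP.
    move=> [t /matchingP[a [da _ h1]]].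
    have := same_pattern_isSome (@label_matching_pattern q w) (dqi _ da).
    rewrite h1; case h2: (label0 _) => [t'|] // _.
    by exists t'; apply/matchingP; exists (ap p a); split=> //; exact: dqi.
  move=> [t /matchingP[b [/dq[a da <-] h1 _]]].
  have := same_pattern_isSome (@label_matching_pattern p (pull q w)) da.
  rewrite h1; case h2: (label0 _) => [t'|] // _.
  by exists t'; apply/matchingP; exists a.
- apply/setP => i; apply/grngP/grngP.
    move=> [t /matchingP[a [/dr da _ h1]]].
    have := same_pattern_isSome (@label_matching_pattern q w) (dqi _ da).
    rewrite -ar// h1; case h2: (label0 _) => [t'|] // _.
    by exists t'; apply/matchingP; exists (ap p a); rewrite -ar//; split=> //; exact: dqi.
  move=> [t /matchingP[b [/dq[a da <-] _ h1]]].
  have /dr da' := da.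
  have := same_pattern_isSome (@label_matching_pattern r w) da'.
  rewrite ar// h1; case h2: (label0 _) => [t'|] // _.
  by exists t'; apply/matchingP; exists a; rewrite ar.
move=> i t u /matchingP[a [da h1 h2]] /matchingP[b [db h3 h4]].
have h5 : label0 (base X a, pull r w) = Some i by rewrite (pull_comp w e).
have /dr da' := da.
have := same_pattern_isSome (@label_matching_pattern r w) da'; rewrite h5.
case h6: (label0 _) => [u'|] // _.
suff <- : u' = u by apply/matchingP; exists a.
have h7 : (t, u') \in label_matching q w.
  by apply/matchingP; exists (ap p a); rewrite -ar//; split=> //; exact: dqi.
have h8 : (t, u) \in label_matching q w by apply/matchingP; exists b.
by have := label_matching_bij h7 h8; rewrite eqxx => /esym/eqP.
Qed.

Lemma step_cover : is_cover step_proj.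
Proof.
have projK (D : {set X}) l : step_proj @: lift_edge D l = D.
  by rewrite /lift_edge -imset_comp imset_id.
split.
- by move=> _ /step_edgesP[C [l [CX lC ->]]]; rewrite projK.
- move=> _ /step_edgesP[C [l [CX lC ->]]] [x l1] [y l2] /lift_edgeP[/= _ ->].
  by move=> /lift_edgeP[/= _ ->]; rewrite /step_proj /= => ->.
- exact: step_lift.
- by move=> v; rewrite projK.
- by [].
- by move=> p v; rewrite /step_proj step_actE.
- exact: step_comp.
Qed.

(** A vertex over [x] is labelled by the label that it carries for [x].
Hence no set on which [w] has no global labelling survives in the cover. *)
Lemma step_realizes w : realizable w ->
  exists l : step -> option S, forall u v, adj u v ->
    ((step_proj u, step_proj v) \in w) = (l u == l v) && isSome (l u).
Proof.
move=> rw; exists (fun v : X * labeling => v.2 (v.1, w)) => u v /step_adj_common.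
move=> [C [l [CX lC [uC vC] -> ->]]]; rewrite !ffunE /= !(cl_refl CX)//.
by rewrite -lC// /effective asboolT.
Qed.

End Step.

(** * Conformal covers and clique separators *)

Section Conformal.
Variables (A P : Type) (dom : P -> A -> Prop) (ap : P -> A -> A).
Implicit Types X : system dom ap.

(** An edge meets [M] in at most [k] points, which can get distinct labels,
whereas a clique of size [k + 1] over [M] would need [k + 1] labels. *)
Lemma realizable_eq_pattern X k (M : {set X}) : ~~ face M -> #|M| <= k.+1 ->
  realizable 'I_k [set xy : X * X | (xy.1 == xy.2) && (xy.1 \in M)].
Proof.
move=> nM Mk C CX; pose D := C :&: M.
have Dk : #|D| <= k.
  rewrite -ltnS; apply: leq_trans Mk; apply: proper_card.
  rewrite properE finset.subsetIr /=; apply: contra nM => h; apply/faceP; exists C => //.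
  exact: fintype.subset_trans h (finset.subsetIl _ _).
(* the label of a point is its position among the at most k points of M in C *)
exists (fun x => if x \in M then insub (index x (enum D)) else None) => x y xC yC.
rewrite inE /=; case: (boolP (x \in M)) => xM; rewrite ?andbF ?andbT//.
have lt z : z \in C -> z \in M -> index z (enum D) < k.
  move=> zC zM; apply: leq_trans Dk; rewrite cardE index_mem mem_enum inE.
  by rewrite zC zM.
case: insubP => [i _ ix|]; last by rewrite lt.
rewrite andbT; case: ifP => yM; last by apply/eqP => xy; rewrite -xy xM in yM.
case: insubP => [j _ jy|]; last by rewrite lt.
apply/eqP/eqP => [xy|[ij]]; first by congr Some; apply: val_inj; rewrite ix jy xy.
rewrite -[x](@nth_index _ x _ (enum D)) ?mem_enum ?inE ?xC//.
by rewrite -ix ij jy nth_index// mem_enum inE yC.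
Qed.

Lemma step_conformal_upto X k :
  conformal_upto k X -> conformal_upto k.+1 (step X 'I_k).
Proof.
move=> cX M cM Mk; have fc := step_cover X 'I_k.
have [fM|fM] := boolP (face (@step_proj _ _ _ _ X 'I_k @: M)).
  exact: (cover_lift fc cM).
have cM' := cover_clique fc cM.
have leM : #|@step_proj _ _ _ _ X 'I_k @: M| <= k.+1.
  by apply: leq_trans Mk; apply: leq_imset_card.
have [l hl] := step_realizes (realizable_eq_pattern fM leM).
have cMP := cliqueP _ cM.
have ls u : u \in M -> isSome (l u).
  move=> uM; have := hl u u (cMP _ _ uM uM).
  by rewrite inE /= !eqxx imset_f//= => <-.
have lI : {in M &, injective l}.
  move=> u v uM vM e; have := hl u v (cMP _ _ uM vM).
  rewrite inE /= e eqxx ls// imset_f// !andbT => /eqP.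
  exact: (cover_adj_inj fc (cMP _ _ uM vM)).
exfalso; move: fM; rewrite (cX _ cM')//.
rewrite (leq_trans (leq_imset_card _ _))// -(card_in_imset lI).
have : l @: M \subset [set~ None].
  by apply/fintype.subsetP => _ /imsetP[u uM ->]; have := ls u uM; rewrite !inE; case: (l u).
by move=> /subset_leq_card; rewrite cardsC1 card_option card_ord.
Qed.

Lemma conformal_upto_cover X k : exists (Y : system dom ap) (f : Y -> X),
  is_cover f /\ conformal_upto k Y.
Proof.
elim: k => [|k [Y [f [fc cY]]]].
  exists X, id; split; first exact: cover_id.
  move=> M _; rewrite leqn0 cards_eq0 => /eqP->.
  by have [C CX _] := base_edge X; apply/faceP; exists C => //; apply: finset.sub0set.
exists (step Y 'I_k), (f \o @step_proj _ _ _ _ Y 'I_k); split.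
  by apply: cover_trans fc; exact: step_cover.
exact: step_conformal_upto.
Qed.

(** Cliques inject into the covered system, which bounds their size. *)
Lemma conformal_cover X : exists (Y : system dom ap) (f : Y -> X),
  is_cover f /\ conformal Y.
Proof.
have [Y [f [fc cY]]] := conformal_upto_cover X #|X|; exists Y, f; split=> // M cM.
by apply: cY => //; rewrite -(card_in_imset (cover_clique_inj fc cM)) max_card.
Qed.

End Conformal.

Section Separator.
Variables (A P : Type) (dom : P -> A -> Prop) (ap : P -> A -> A).
Variable (X : system dom ap).

(** An analogue of the vanishing of the first cohomology with coefficients in
[Z/2]: a realizable pattern with two labels is locally trivial, and here it has
to be trivial on [M].  The pattern [twist] plays the role of the class of a cycle
through two components of the complement of a separator. *)
Definition trivializes (M : {set X}) : Prop :=
  forall w : {set X * X}, realizable bool w ->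
  exists l : X -> option bool, forall x y, x \in M -> y \in M -> adj x y ->
    ((x, y) \in w) = (l x == l y) && isSome (l x).

Lemma trivializes_sub (M M' : {set X}) : M' \subset M -> trivializes M -> trivializes M'.
Proof.
move=> /fintype.subsetP s h w /h[l hl]; exists l => x y /s xM /s yM; exact: hl.
Qed.

Section Fixed.
Variables (W S : {set X}) (a b : X).

(** Adjacency in the graph induced on [W] minus [S]. *)
Definition outside_adj (x y : X) : bool := [&& x \in W :\: S, y \in W :\: S & adj x y].

Definition component (c : X) : {set X} := [set x | connect outside_adj c x].

Lemma outside_adj_sym : connect_sym outside_adj.
Proof. by apply: sym_connect_sym => x y; rewrite /outside_adj adj_sym andbCA. Qed.

Lemma component_refl c : c \in component c.
Proof. by rewrite inE connect0. Qed.

Lemma component_step c x y : x \in component c -> outside_adj x y -> y \in component c.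
Proof. by rewrite !inE => cx xy; apply: connect_trans cx (connect1 xy). Qed.

Lemma component_sub c : c \in W :\: S -> component c \subset W :\: S.
Proof.
move=> cW; apply/fintype.subsetP => x; rewrite [x \in component c]inE => cx.
have cl : fingraph.closed outside_adj (mem (W :\: S)).
  by move=> y z /and3P[yW zW _]; rewrite yW zW.
by have := closed_connect cl cx; rewrite cW => <-.
Qed.

Lemma component_closed c x y : c \in W :\: S -> x \in component c -> adj x y -> y \in W ->
  (y \in S) || (y \in component c).
Proof.
move=> cW xc xy yW; case: (boolP (y \in S)) => //= yS; apply: (component_step xc).
by rewrite /outside_adj (fintype.subsetP (component_sub cW)) // xy finset.in_setD yS yW.
Qed.

End Fixed.

(** By minimality of the separator [S]: if [s] had no neighbour in the
component of [a], that component would still be a component without [s] in the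
separator. *)
Lemma separator_nbr W S a b s : a \in W :\: S -> b \in W :\: S -> s \in S -> s \in W ->
    ~~ connect (outside_adj W S) a b -> connect (outside_adj W (S :\ s)) a b ->
  exists2 x, x \in component W S a & adj s x.
Proof.
move=> aW bW sS sW nab ab.
case: (boolP [exists x in component W S a, adj s x]) => [/exists_inP[x xa sx]|].
  by exists x.
move=> /exists_inPn h.
have cl : fingraph.closed (outside_adj W (S :\ s)) (mem (component W S a)).
  apply: intro_closed; first exact: outside_adj_sym.
  move=> x y /and3P[_ yW xy]; move=> xa.
  have yW' : y \in W by move: yW; rewrite inE => /andP[].
  have /orP[yS|//] := component_closed aW xa xy yW'.
  move: yW; rewrite !inE yS yW' !andbT negbK => /eqP ys.
  by have := h x xa; rewrite -ys adj_sym xy.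
by have := closed_connect cl ab; rewrite component_refl inE (negbTE nab).
Qed.

(** All labels on [s], [t], [Qa] and [Qb] are to be equal, except that [t]
and the points of [Qb] get different labels. *)
Definition twist (s t : X) (Qa Qb : {set X}) : {set X * X} :=
  let D := [set s; t] :|: (Qa :|: Qb) in
  [set xy | [&& xy.1 \in D, xy.2 \in D, ~~ ((xy.1 == t) && (xy.2 \in Qb))
      & ~~ ((xy.2 == t) && (xy.1 \in Qb))]].

(** An edge containing [t] avoids [s], and every edge meets at most one of [Qa]
and [Qb].  So on an edge containing [t] the labels of [Qb] can be flipped, and on any other
edge all labels are taken equal. *)
Lemma realizable_twist s t (Qa Qb : {set X}) : t \notin Qb -> ~~ adj s t ->
  {in Qa & Qb, forall x y, ~~ adj x y} -> realizable bool (twist s t Qa Qb).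
Proof.
move=> tQb nst nab C CX; set D := [set s; t] :|: (Qa :|: Qb).
have nadj x y : x \in C -> y \in C -> x \in Qa -> y \in Qb -> False.
  by move=> xC yC xa yb; have /negP := nab _ _ xa yb; apply; apply/adjP; exists C.
exists (fun x => if x \in D then Some ((x \in Qb) && (t \in C)) else None) => x y xC yC.
rewrite inE /= -/D; case: (boolP (x \in D)) => xD; last by rewrite andbF.
rewrite andbT; case: (boolP (y \in D)) => yD //=.
rewrite [RHS](_ : _ = ((x \in Qb) && (t \in C) == (y \in Qb) && (t \in C)))//.
case: (boolP (t \in C)) => tC; last first.
  have nt z : z \in C -> z == t = false by move=> zC; apply: contraNF tC => /eqP<-.
  by rewrite !nt// !andbF.
have ns z : z \in C -> z == s = false.
  by move=> zC; apply: contraNF nst => /eqP<-; apply/adjP; exists C.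
have tQb' z : z == t -> z \in Qb = false by move=> /eqP->; exact: negbTE.
move: xD yD; rewrite !inE !ns//= !andbT.
case: (boolP (x == t)) => [/tQb' ->|xt] /=; case: (boolP (y == t)) => [/tQb' ->|yt] //=.
- by move=> *; case: (y \in Qb).
move=> /orP[xa|xb] /orP[ya|yb].
- case: (boolP (x \in Qb)) => [/(nadj _ _ xC xC xa)//|_].
  by case: (boolP (y \in Qb)) => // /(nadj _ _ xC yC xa).
- by case: (nadj _ _ xC yC xa yb).
- by case: (nadj _ _ yC xC ya xb).
by rewrite xb yb.
Qed.

(** Follow the labels of a global realization of [twist] around a cycle: from
[s] through the component of [a] to [t] they do not change, and from [s] through
the component of [b] to [t] they change once. *)
Lemma separator_clique (W S : {set X}) a b s t :
    trivializes W -> S \subset W -> a \in W :\: S -> b \in W :\: S ->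
    ~~ connect (outside_adj W S) a b ->
    {in S, forall x, exists2 y, y \in component W S a & adj x y} ->
    {in S, forall x, exists2 y, y \in component W S b & adj x y} ->
  s \in S -> t \in S -> adj s t.
Proof.
move=> tW /fintype.subsetP SW aW bW nab na nb sS tS.
case: (boolP (adj s t)) => // nst; exfalso.
set Qa := component W S a; set Qb := component W S b.
have inQ c x : c \in W :\: S -> x \in component W S c -> (x \in W) /\ (x \notin S).
  by move=> cW /(fintype.subsetP (component_sub cW)); rewrite inE => /andP[].
have tQb : t \notin Qb by apply/negP => /(inQ _ _ bW)[]; rewrite tS.
have sQb : s \notin Qb by apply/negP => /(inQ _ _ bW)[]; rewrite sS.
have nadj : {in Qa & Qb, forall x y, ~~ adj x y}.
  move=> x y xa yb; apply/negP => xy.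
  have [yW yS] := inQ _ _ bW yb.
  have := component_closed aW xa xy yW; rewrite (negbTE yS) /= inE => ay.
  move: nab; rewrite (connect_trans ay)// outside_adj_sym.
  by move: yb; rewrite inE.
have [l hl] := tW _ (realizable_twist tQb nst nadj).
have st : s != t.
  apply: contraNneq nst => ->; have [y _ ty] := na t tS; exact: adj_refll ty.
have tw x y : x \in [set s; t] :|: (Qa :|: Qb) -> y \in [set s; t] :|: (Qa :|: Qb) ->
    x \in W -> y \in W -> adj x y ->
    (l x == l y) && isSome (l x) = ~~ ((x == t) && (y \in Qb)) && ~~ ((y == t) && (x \in Qb)).
  by move=> xD yD xW yW xy; rewrite -hl// inE /= xD yD.
have sD : s \in [set s; t] :|: (Qa :|: Qb) by rewrite !inE eqxx.
have tD : t \in [set s; t] :|: (Qa :|: Qb) by rewrite !inE eqxx orbT.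
have aD x : x \in Qa -> x \in [set s; t] :|: (Qa :|: Qb) by rewrite !inE => ->; rewrite !orbT.
have bD x : x \in Qb -> x \in [set s; t] :|: (Qa :|: Qb) by rewrite !inE => ->; rewrite !orbT.
(* a component is connected, so the labels are constant on it *)
have const c : c \in W :\: S -> {in component W S c, forall x, x != t} ->
    {in component W S c, forall x, x \in [set s; t] :|: (Qa :|: Qb)} ->
    {in component W S c, forall x, l x = l c}.
  move=> cW ct cD x cx.
  have cl : fingraph.closed (outside_adj W S) [pred x | (x \in component W S c) && (l x == l c)].
    apply: intro_closed; first exact: outside_adj_sym.
    move=> y z yz; rewrite !inE => /andP[cy /eqP yc].
    have cz := connect_trans cy (connect1 yz); rewrite cz /=.
    have {}cy : y \in component W S c by rewrite inE.
    have {}cz : z \in component W S c by rewrite inE.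
    have [_ _ a_yz] := and3P yz.
    have := tw y z (cD _ cy) (cD _ cz) (inQ _ _ cW cy).1 (inQ _ _ cW cz).1 a_yz.
    by rewrite (negbTE (ct _ cy)) (negbTE (ct _ cz)) /= yc => /andP[/eqP->].
  move: cx; rewrite inE => /(closed_connect cl); rewrite !inE connect0 eqxx /=.
  by move=> /esym/andP[_ /eqP].
have nt c x : c \in W :\: S -> x \in component W S c -> x != t.
  by move=> cW /(inQ _ _ cW)[_]; apply: contraNneq => ->.
have ca := const a aW (fun x => @nt a x aW) aD.
have cb := const b bW (fun x => @nt b x bW) bD.
have [x xa sx] := na s sS; have [x' xa' tx'] := na t tS.
have [y yb sy] := nb s sS; have [y' yb' ty'] := nb t tS.
have x'b : x' \notin Qb.
  apply/negP => x'b; have := nadj _ _ xa' x'b.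
  by rewrite (adj_refll (y := t)) // adj_sym.
have SWs z : z \in S -> z \in W by exact: SW.
have := tw s x sD (aD _ xa) (SW _ sS) (inQ _ _ aW xa).1 sx.
rewrite (negbTE st) (negbTE (nt _ _ aW xa)) /= (ca x)// => /andP[/eqP sa _].
have := tw t x' tD (aD _ xa') (SW _ tS) (inQ _ _ aW xa').1 tx'.
rewrite (negbTE x'b) (negbTE (nt _ _ aW xa')) eqxx /= (ca x')// => /andP[/eqP ta ha].
have := tw s y sD (bD _ yb) (SW _ sS) (inQ _ _ bW yb).1 sy.
rewrite (negbTE st) (negbTE (nt _ _ bW yb)) /= (cb y)// => /andP[/eqP s_b _].
have := tw t y' tD (bD _ yb') (SW _ tS) (inQ _ _ bW yb').1 ty'.
by rewrite eqxx yb' /= (cb y')// ha ta -sa -s_b eqxx.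
Qed.

(** A minimal set separating two nonadjacent vertices is a clique, hence a
face.  The pieces are closed because a point in the closure of [x] is adjacent to
all neighbours of [x]; in particular the separator is closed. *)
Lemma clique_separator (W : {set X}) :
    conformal X -> trivializes W -> closed W -> {in W, forall x, adj x x} ->
    ~~ clique W ->
  exists U1 U2 : {set X},
    [/\ closed U1 /\ U1 \proper W, closed U2 /\ U2 \proper W, U1 :|: U2 = W,
        face (U1 :&: U2)
      & forall K : {set X}, K \subset W -> clique K -> K \subset U1 \/ K \subset U2].
Proof.
move=> cX tW /closedP clW Wadj nW.
have [a [b [aW bW ab]]] : exists a b, [/\ a \in W, b \in W & ~~ adj a b].
  move: nW; rewrite /clique => /forall_inPn[a aW /forall_inPn[b bW ab]].
  by exists a, b.
pose sep (S : {set X}) :=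
  [&& S \subset W, a \notin S, b \notin S & ~~ connect (outside_adj W S) a b].
(* two nonadjacent vertices are separated by all the others *)
have sep0 : sep (W :\ a :\ b).
  apply/and4P; split; rewrite ?inE ?eqxx ?andbF//.
    by rewrite (fintype.subset_trans (finset.subD1set _ _))// finset.subD1set.
  apply/negP => h.
  have cl : fingraph.closed (outside_adj W (W :\ a :\ b)) [pred x | x == a].
    apply: intro_closed; first exact: outside_adj_sym.
    move=> x y /and3P[_ yW xy]; rewrite !inE => /eqP xa.
    move: yW; rewrite !inE => /andP[h1 h2]; move: h1; rewrite h2 andbT negb_and !negbK.
    by case/orP => // /eqP yb; move: ab; rewrite -xa -yb xy.
  have := closed_connect cl h; rewrite !inE eqxx => /esym/eqP ba.
  by move: ab; rewrite ba Wadj.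
have [S /and4P[SW aS bS nab] minS] := @arg_minnP _ _ sep (fun S => #|S|) sep0.
have aWS : a \in W :\: S by rewrite inE aS.
have bWS : b \in W :\: S by rewrite inE bS.
have conn s : s \in S -> connect (outside_adj W (S :\ s)) a b.
  move=> sS; apply/negPn/negP => h.
  have := minS (S :\ s); rewrite /sep h !inE !negb_and aS bS !orbT /= andbT.
  rewrite (fintype.subset_trans (finset.subD1set _ _) SW) => /(_ isT).
  by rewrite (cardsD1 s S) sS add1n ltnn.
have na : {in S, forall x, exists2 y, y \in component W S a & adj x y}.
  by move=> s sS; apply: (separator_nbr aWS bWS sS (fintype.subsetP SW _ sS) nab (conn s sS)).
have nb : {in S, forall x, exists2 y, y \in component W S b & adj x y}.
  move=> s sS; apply: (separator_nbr bWS aWS sS (fintype.subsetP SW _ sS)).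
    by rewrite outside_adj_sym.
  by rewrite outside_adj_sym; exact: conn.
have Sclique : clique S.
  by apply/cliqueP => s t; exact: separator_clique nab na nb.
have Qa_sub := fintype.subsetP (component_sub aWS).
have Qa_closed x y : x \in component W S a -> adj x y -> y \in W -> y \in S :|: component W S a.
  by move=> xa xy yW; rewrite inE; exact: component_closed xa xy yW.
have SW' := fintype.subsetP SW.
have US : (S :|: component W S a) :&: (W :\: component W S a) = S.
  apply/setP => x; rewrite !finset.in_setI finset.in_setU finset.in_setD.
  case: (boolP (x \in component W S a)) => xa; rewrite ?andbF ?orbF //=.
    by move: (Qa_sub _ xa); rewrite inE => /andP[/negbTE ->].
  by apply/andP/idP => [[]//|xS]; rewrite xS SW'.
exists (S :|: component W S a), (W :\: component W S a); split.
- split.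
    apply/closedP => x xU; apply/fintype.subsetP => y yx.
    have yW : y \in W.
      apply: (fintype.subsetP (clW x _) y yx).
      by move: xU; rewrite inE => /orP[/SW'//|/Qa_sub]; rewrite inE => /andP[].
    move: xU; rewrite inE => /orP[xS|xa].
      have [z za xz] := na x xS.
      by apply: (Qa_closed z) => //; apply: adj_cl yx; rewrite adj_sym.
    apply: (Qa_closed x) => //; apply: adj_cl yx; apply: Wadj.
    by have := Qa_sub _ xa; rewrite inE => /andP[].
  rewrite properE; apply/andP; split.
    apply/fintype.subsetP => x; rewrite inE => /orP[/SW'//|/Qa_sub].
    by rewrite inE => /andP[].
  apply/negP => /fintype.subsetP/(_ b bW); rewrite inE (negbTE bS) /= inE.
  exact/negP.
- split.
    apply/closedP => x; rewrite finset.in_setD => /andP[xa xW].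
    apply/fintype.subsetP => y yx; have yW := fintype.subsetP (clW x xW) y yx.
    rewrite finset.in_setD yW andbT; apply/negP => ya.
    have yx' : adj y x by rewrite adj_sym; apply: adj_cl yx; exact: Wadj.
    have := Qa_closed _ _ ya yx' xW; rewrite inE (negbTE xa) orbF => xS.
    have [z zb xz] := nb x xS.
    have zy : adj y z by rewrite adj_sym; apply: adj_cl yx; rewrite adj_sym.
    have zWS := fintype.subsetP (component_sub bWS) _ zb.
    have zW : z \in W by move: zWS; rewrite inE => /andP[].
    have := Qa_closed _ _ ya zy zW; rewrite inE.
    move: zWS; rewrite inE => /andP[/negbTE -> _] /=; rewrite inE => az.
    move: nab; rewrite (connect_trans az)// outside_adj_sym.
    by move: zb; rewrite inE.
  rewrite properE finset.subsetDl /=; apply/negP => /fintype.subsetP/(_ a aW).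
  by rewrite finset.in_setD component_refl.
- apply/setP => x; rewrite finset.in_setU finset.in_setU finset.in_setD.
  case: (boolP (x \in component W S a)) => xa; rewrite ?orbT /=.
    by move: (Qa_sub _ xa); rewrite inE => /andP[_ ->].
  by rewrite orbF; apply/orP/idP => [[/SW'|]//|]; right.
- by rewrite US; exact: cX.
- move=> K /fintype.subsetP KW /cliqueP cK.
  case: (boolP [exists x in K, x \in component W S a]) => [/exists_inP[x xK xa]|/exists_inPn h].
    by left; apply/fintype.subsetP => y yK; apply: (Qa_closed x) => //; [exact: cK|exact: KW].
  by right; apply/fintype.subsetP => y yK; rewrite finset.in_setD KW// h.
Qed.

End Separator.

(** * Tree-like covers *)

Section TreeLike.
Variables (A P : Type) (dom : P -> A -> Prop) (ap : P -> A -> A).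
Implicit Types X Y Z : system dom ap.

Definition nonadj X (M : {set X}) : {set X * X} :=
  [set xy in finset.setX M M | ~~ adj xy.1 xy.2].

Lemma nonadjP X (M : {set X}) x y :
  (x, y) \in nonadj M = [&& x \in M, y \in M & ~~ adj x y].
Proof. by rewrite inE finset.in_setX /= andbA. Qed.

(** Every nonadjacent pair of the image lifts to a nonadjacent pair, so a
nonadjacent pair with adjacent image would make the count in [M] larger. *)
Lemma nonadj_reflect X Y (f : X -> Y) (M : {set X}) : is_cover f ->
  #|nonadj M| <= #|nonadj (f @: M)| ->
  {in M &, forall x y, adj (f x) (f y) -> adj x y}.
Proof.
move=> fc le x y xM yM xy; case: (boolP (adj x y)) => // nxy; exfalso.
pose ff (uv : X * X) := (f uv.1, f uv.2).
have sub : nonadj (f @: M) \subset ff @: (nonadj M :\ (x, y)).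
  apply/fintype.subsetP => -[u' v']; rewrite nonadjP.
  move=> /and3P[/imsetP[u uM ->] /imsetP[v vM ->] nuv].
  apply/imsetP; exists (u, v) => //; rewrite inE nonadjP uM vM inE /=; apply/andP; split.
    by apply: contra nuv => /eqP[-> ->].
  by apply: contra nuv; exact: cover_adj.
move: le; rewrite leqNgt => /negP; apply.
apply: leq_ltn_trans (subset_leq_card sub) _; apply: leq_ltn_trans (leq_imset_card _ _) _.
by rewrite (cardsD1 (x, y) (nonadj M)) nonadjP xM yM nxy.
Qed.

(** If no adjacency is lost between [M] and its image, the labels that the
cover carries on [M] descend to the image. *)
Lemma step_trivializes X (M : {set step X bool}) :
  #|nonadj M| <= #|nonadj (@step_proj _ _ _ _ X bool @: M)| ->
  trivializes (@step_proj _ _ _ _ X bool @: M).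
Proof.
move=> le w /step_realizes[l hl].
have refl := nonadj_reflect (step_cover X bool) le.
exists (fun x => if [pick u in M | step_proj u == x] is Some u then l u else None).
have pickM x : x \in @step_proj _ _ _ _ X bool @: M ->
    exists2 u, u \in M & step_proj u = x /\ [pick u in M | step_proj u == x] = Some u.
  move=> /imsetP[v vM ->]; case: pickP => [u /andP[uM /eqP e]|/(_ v)].
    by exists u.
  by rewrite vM eqxx.
move=> x y /pickM[u uM [<- ->]] /pickM[v vM [<- ->]] uv.
exact: hl (refl _ _ uM vM uv).
Qed.

Definition treelike X Y (f : Y -> X) (M : {set Y}) : Prop :=
  exists (Z : system dom ap) (g : Y -> Z) (h : Z -> X),
    [/\ is_cover g, is_cover h, f =1 h \o g, conformal Z & trivializes (g @: M)].

(** By induction on the number of nonadjacent pairs.  In one more step, either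
[M] has more nonadjacent pairs than its image, which is handled by the induction
hypothesis, or [step_trivializes] applies to the last projection. *)
Lemma treelike_cover X n : conformal X ->
  exists (Y : system dom ap) (f : Y -> X), [/\ is_cover f, conformal Y
    & forall M : {set Y}, #|M| <= n -> treelike f M].
Proof.
move=> cX.
(* a set of at most n points has at most n * n nonadjacent pairs *)
suff [Y [f [fc cY hM]]] : exists (Y : system dom ap) (f : Y -> X), [/\ is_cover f, conformal Y
    & forall M : {set Y}, #|nonadj M| < (n * n).+1 -> treelike f M].
  exists Y, f; split=> // M Mn; apply: hM; rewrite ltnS.
  apply: leq_trans (leq_mul Mn Mn); rewrite -cardsX subset_leq_card//.
  by apply/fintype.subsetP => xy; rewrite inE => /andP[].
elim: (n * n).+1 => [|m [Y [f [fc cY hM]]]].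
  by exists X, id; split=> //; exact: cover_id.
have pc := step_cover Y bool.
exists (step Y bool), (f \o @step_proj _ _ _ _ Y bool); split.
- exact: cover_trans pc fc.
- exact: cover_conformal pc cY.
move=> M; rewrite ltnS => Mm.
have [lt|ge] := ltnP #|nonadj (@step_proj _ _ _ _ Y bool @: M)| m.
  have [Z [g [h [gc hc e cZ tZ]]]] := hM _ lt.
  exists Z, (g \o @step_proj _ _ _ _ Y bool), h; split=> //.
  - exact: cover_trans pc gc.
  - by move=> u /=; rewrite e.
  - by rewrite imset_comp.
exists Y, (@step_proj _ _ _ _ Y bool), f; split=> //.
by apply: step_trivializes; apply: leq_trans Mm ge.
Qed.

End TreeLike.

Local Open Scope classical_set_scope.

(** * Embeddings of structures with unary functions *)

Section Toolbox.
Variable L : language.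
Hypothesis L_unary : forall F : fun_sym L, fun_arity F = 1.
Variable G : lperm_group L.
Implicit Types (A B C D : structure L) (s t : lmap L).

Lemma lmap_compA s t u : lmap_comp s (lmap_comp t u) = lmap_comp (lmap_comp s t) u.
Proof. by []. Qed.

Lemma lmap_comp1l s : lmap_comp (lmap_id L) s = s.
Proof. by case: s. Qed.

Lemma lmap_comp1r s : lmap_comp s (lmap_id L) = s.
Proof. by case: s. Qed.

Lemma lperm_inv s : G s -> exists t, [/\ G t, lmap_comp s t = lmap_id L &
  lmap_comp t s = lmap_id L].
Proof. by move=> /lpg_inv[t Gt [st ts]]; exists t. Qed.

Lemma lperm_cancel_l s t u : G s -> lmap_comp s t = lmap_comp s u -> t = u.
Proof.
move=> /lperm_inv[v [_ _ vs]] e.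
by rewrite -[t]lmap_comp1l -[u]lmap_comp1l -vs -!lmap_compA e.
Qed.

Lemma lperm_cancel_r s t u : G s -> lmap_comp t s = lmap_comp u s -> t = u.
Proof.
move=> /lperm_inv[v [_ sv _]] e.
by rewrite -[t]lmap_comp1r -[u]lmap_comp1r -sv !lmap_compA e.
Qed.

Lemma lperm_quotient s t : G s -> G t -> exists u, G u /\ lmap_comp s u = t.
Proof.
move=> /lperm_inv[v [Gv sv _]] Gt; exists (lmap_comp v t); split; first exact: lpg_comp.
by rewrite lmap_compA sv lmap_comp1l.
Qed.

Lemma lperm_on_fun s F : G s -> exists F', on_fun s F' = F.
Proof.
move=> /lperm_inv[v [_ sv _]]; exists (on_fun v F).
exact: (congr1 (fun z => on_fun z F) sv).
Qed.

Lemma lperm_on_rel s R : G s -> exists R', on_rel s R' = R.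
Proof.
move=> /lperm_inv[v [_ sv _]]; exists (on_rel v R).
exact: (congr1 (fun z => on_rel z R) sv).
Qed.

Lemma fun_in_unary A F (x : seq A) y : fun_in F x y -> exists x0, x = [:: x0].
Proof.
case: (eqVneq (size x) 1) => [|n1].
  by case: x => [|x0 [|]]// _ _; exists x0.
by rewrite fun_in_size// L_unary; apply/eqP.
Qed.

(** With unary functions, only tuples of length one have to be considered; on
the others all functions are empty. *)
Lemma emb_funP A B (s : lmap L) (f : A -> B) :
    (forall x F, f @` fun_in F [:: x] = fun_in (on_fun s F) [:: f x]) ->
  forall F (x : seq A), f @` fun_in F x = fun_in (on_fun s F) (map f x).
Proof.
move=> h F x; case: (eqVneq (size x) 1) => [|n1].
  by case: x => [|x [|]]// _; exact: h.
rewrite !fun_in_size ?size_map ?L_unary//; try exact/eqP.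
by rewrite image_set0.
Qed.

Fixpoint within (T : Type) (U : T -> Prop) (t : seq T) : Prop :=
  if t is x :: t' then U x /\ within U t' else True.

Lemma within_map (T T' : Type) (f : T -> T') (U : T' -> Prop) (t : seq T) :
  within U (map f t) <-> within (U \o f) t.
Proof. by elim: t => //= x t ->. Qed.

Lemma within_mono (T : Type) (U V : T -> Prop) (t : seq T) :
  (forall x, U x -> V x) -> within U t -> within V t.
Proof. by move=> UV; elim: t => //= x t IH [/UV Vx /IH]. Qed.

Lemma within_true (T : Type) (U : T -> Prop) (t : seq T) : (forall x, U x) -> within U t.
Proof. by move=> Ux; elim: t. Qed.

Lemma within_ex (T T' : Type) (f : T -> T') (t : seq T') :
  within (fun y => exists x, f x = y) t -> exists t1 : seq T, t = map f t1.
Proof.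
elim: t => [|y t IH] /=; first by exists [::].
by move=> [[x <-] /IH[t' ->]]; exists (x :: t').
Qed.

(** Closure under the unary functions; this is what it means for a set of
vertices to be a substructure ([is_subP]). *)
Definition closed_set A (U : set A) : Prop :=
  forall F x y, U x -> fun_in F [:: x] y -> U y.

Lemma is_subP A (U : set A) : is_sub G U <-> closed_set U.
Proof.
split=> [[_ _ _ h] F x y Ux xy|clU].
  have := h F [:: SigSub (mem_set Ux)]; rewrite /= => /(congr1 (fun S => S y)) /= e.
  have : fun_in F [:: x] y by [].
  by rewrite -e => -[u _ <-]; exact: set_mem (valP u).
split=> //=; [exact: lpg_id|exact: val_inj|].
apply: (@emb_funP (induced U) A (lmap_id L) _) => x F /=.
apply/seteqP; split=> [_ [u ux <-]//|y xy].
have Uy : U y by apply: clU xy; exact: set_mem (valP x).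
by exists (SigSub (mem_set Uy)).
Qed.

Lemma smap_eq A B (f g : smap A B) : lpart f = lpart g -> vpart f =1 vpart g -> f = g.
Proof. by case: f g => [s f] [t g] /= -> /funext ->. Qed.

Lemma is_emb_comp A B C (f : smap A B) (g : smap B C) :
  is_emb G f -> is_emb G g -> is_emb G (smap_comp g f).
Proof.
move=> [Gf fI fR fF] [Gg gI gR gF]; split=> /=.
- exact: lpg_comp.
- exact: inj_comp.
- by move=> R x; rewrite fR gR map_comp.
- by move=> F x; rewrite -image_comp fF gF map_comp.
Qed.

Lemma is_emb_cancel A B D (psi : smap A B) (i : smap D A) :
  is_emb G psi -> is_emb G (smap_comp psi i) -> is_emb G i.
Proof.
move=> [Gf fI fR fF] [/= Gg gI gR gF].
have Gi : G (lpart i).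
  have [u [Gu e]] := lperm_quotient Gf Gg.
  by rewrite -(lperm_cancel_l Gf e).
split=> //.
- by move=> x y e; apply: gI; rewrite /= e.
- by move=> R x; rewrite gR fR map_comp.
- move=> F x; apply/seteqP; split=> [_ [y xy <-]|y xy].
    have : fun_in (on_fun (lpart psi) (on_fun (lpart i) F)) (map psi (map i x)) (psi (i y)).
      by rewrite -map_comp -gF; exists y.
    by rewrite -fF => -[z xz /fI <-].
  have : (psi @` fun_in (on_fun (lpart i) F) (map i x)) (psi y) by exists y.
  by rewrite fF -map_comp -gF => -[z xz /fI <-]; exists z.
Qed.

Lemma closed_range A B (f : smap A B) : is_emb G f -> closed_set (range f).
Proof.
move=> [Gf fI fR fF] F _ y [x _ <-].
have [F' <-] := lperm_on_fun F Gf.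
by have /= <- := fF F' [:: x] => -[z _ <-]; exists z.
Qed.

(** An embedding of the part of [B] inside [U], with the values of functions
taken in all of [B], also where they leave [U].  Stated for a total map and a set
so that the domain can vary without dependent types. *)
Definition emb_on B C (U : set B) (g : B -> C) (s : lmap L) : Prop :=
  [/\ G s, forall x y : B, U x -> U y -> g x = g y -> x = y,
      forall R (x : seq B), within U x -> (rel_in R x <-> rel_in (on_rel s R) (map g x))
    & forall F x, U x -> g @` fun_in F [:: x] = fun_in (on_fun s F) [:: g x]].

Lemma emb_on_comp D B C (i : smap D B) (U : set B) (g : B -> C) (s : lmap L) :
    is_emb G i -> (forall d, U (i d)) -> emb_on U g s ->
  is_emb G (SMap (lmap_comp s (lpart i)) (g \o i)).
Proof.
move=> [Gi iI iR iF] iU [Gs gI gR gF]; split=> /=.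
- exact: lpg_comp.
- by move=> x y /= e; apply/iI/(gI _ _ (iU x) (iU y)).
- move=> R x; rewrite iR map_comp; apply: gR.
  by apply/within_map/within_true.
- apply: (@emb_funP D C (lmap_comp s (lpart i)) (g \o i)) => x F.
  by rewrite -image_comp iF /= gF.
Qed.

Lemma is_emb_emb_on A B (f : smap A B) (U : set A) : is_emb G f -> emb_on U f (lpart f).
Proof.
by move=> [Gf fI fR fF]; split=> // x y _ _ /fI.
Qed.

Lemma emb_on_factor D B C (i : smap D B) (j : smap D C) (g : B -> C) (s : lmap L) :
    is_emb G i -> is_emb G j -> (forall d, g (i d) = j d) ->
    lmap_comp s (lpart i) = lpart j -> emb_on (range i) g s.
Proof.
move=> [Gi iI iR iF] [Gj jI jR jF] gi si.
have Gs : G s.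
  have [v [Gv iv vi]] := lperm_inv Gi.
  by rewrite -[s]lmap_comp1r -iv lmap_compA si; exact: lpg_comp.
split=> //.
- by move=> _ _ [x _ <-] [y _ <-]; rewrite !gi => /jI ->.
- move=> R x xi.
  have [y ->] : exists y, x = map i y.
    by apply/within_ex/(within_mono _ xi) => z [y _ <-]; exists y.
  have [R' <-] := lperm_on_rel R Gi.
  rewrite -iR jR -map_comp (eq_map gi).
  by rewrite -si.
- move=> F _ [x _ <-].
  have [F' <-] := lperm_on_fun F Gi.
  rewrite -[[:: i x]]/(map i [:: x]) -iF image_comp gi.
  rewrite -[[:: j x]]/(map j [:: x]) (_ : on_fun s _ = on_fun (lpart j) F'); last by rewrite -si.
  by rewrite -jF; congr (_ @` _); apply/funext => y /=; exact: gi.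
Qed.

End Toolbox.

(** * EPPA-witnesses in terms of partial maps of A *)

Section Witness.
Variable L : language.
Hypothesis L_unary : forall F : fun_sym L, fun_arity F = 1.
Variable G : lperm_group L.
Implicit Types (A B C D : structure L).

(** A partial map of [A] with a language part, as a total map with a domain;
values outside the domain are junk. *)
Record pmap A := PMap { pdom : set A; pfun : A -> A; plab : lmap L }.

Definition pauto A (q : pmap A) : Prop :=
  closed_set (pdom q) /\ emb_on G (pdom q) (pfun q) (plab q).

Definition pcomposite A (q1 q2 q3 : pmap A) : Prop :=
  [/\ forall a, pdom q3 a <-> pdom q1 a,
      forall b, pdom q2 b <-> exists2 a, pdom q1 a & pfun q1 a = b,
      forall a, pdom q1 a -> pfun q3 a = pfun q2 (pfun q1 a)
    & plab q3 = lmap_comp (plab q2) (plab q1)].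

(** The extension property read off on [A] instead of on its image in [B].
The proposition [coh] is [True] for coherent witnesses and [False] otherwise.
For partial maps that are not partial automorphisms, [hat] takes some
automorphism as a value, so that it acts in all cases. *)
Definition is_witness (coh : Prop) A B : Prop :=
  exists (psi : smap A B) (hat : pmap A -> smap B B),
    [/\ is_emb G psi, forall q, is_aut G (hat q),
        forall q, pauto q ->
          lmap_comp (lpart (hat q)) (lpart psi) = lmap_comp (lpart psi) (plab q) /\
          forall a, pdom q a -> hat q (psi a) = psi (pfun q a)
      & coh -> forall q1 q2 q3, pauto q1 -> pauto q2 -> pauto q3 ->
          pcomposite q1 q2 q3 -> hat q3 = smap_comp (hat q2) (hat q1)].

Lemma is_aut_id A : is_aut G (SMap (lmap_id L) (@id A)).
Proof.
split; last by exists id.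
by split=> //= [|R x|F x]; [exact: lpg_id|rewrite map_id|rewrite map_id image_id].
Qed.

Section Represent.
Variables (A B : structure L) (psi : smap A B).
Hypothesis psi_emb : is_emb G psi.
Implicit Types (q : pmap A) (U V W : set (image_structure psi)).

Let psi_inj : injective psi. Proof. by case: psi_emb. Qed.

Definition dom_image q : set (image_structure psi) :=
  [set z | exists2 a, pdom q a & psi a = val z].

Definition cod_image q : set (image_structure psi) :=
  [set z | exists2 a, pdom q a & psi (pfun q a) = val z].

(** The partial automorphism [f] of the image of [psi] is the conjugate of
[q] by [psi].  The equations on [U] and [V] are part of the relation, so that
[U] and [V] stay variables and maps between provably equal sets can be composed
without casts. *)
Definition represents q U V (f : smap (induced U) (induced V)) : Prop :=
  [/\ U = dom_image q, V = cod_image q,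
      lmap_comp (lpart f) (lpart psi) = lmap_comp (lpart psi) (plab q)
    & forall u a, psi a = val (val u) -> val (val (f u)) = psi (pfun q a)].

Definition iota U : smap (induced U) B :=
  smap_comp (inclusion (range psi)) (inclusion U).

Lemma iota_emb U : is_sub G U -> is_emb G (iota U).
Proof.
move=> sU; have sR : is_sub G (range psi).
  by apply/(is_subP L_unary)/closed_range; exact: psi_emb.
exact: is_emb_comp sU sR.
Qed.

Lemma range_val (z : image_structure psi) : exists a, psi a = val z.
Proof. by have [a _ e] := set_mem (valP z); exists a. Qed.

(** Pulls substructures of the image of [psi], and maps between them, back to
[A]. *)
Lemma lift_emb D (j : smap D B) : is_emb G j -> (forall d, exists a, psi a = j d) ->
  exists2 i : smap D A, is_emb G i & smap_comp psi i = j.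
Proof.
move=> je /choice[i hi].
have [Gp _ _ _] := psi_emb; have [Gj _ _ _] := je.
have [s [Gs e]] := lperm_quotient Gp Gj.
have e' : smap_comp psi (SMap s i) = j by apply: smap_eq => //= d; rewrite hi.
by exists (SMap s i) => //; apply: (is_emb_cancel psi_emb); rewrite e'.
Qed.

Lemma dom_imageP q (u : induced (dom_image q)) : exists a, pdom q a /\ psi a = val (val u).
Proof. by have [a qa e] := set_mem (valP u); exists a. Qed.

Lemma represents_uniq q U V (f g : smap (induced U) (induced V)) :
  represents q f -> represents q g -> f = g.
Proof.
move=> [_ _ lf hf] [_ _ lg hg].
have [Gp _ _ _] := psi_emb; apply: smap_eq.
  by apply: (lperm_cancel_r Gp); rewrite lf lg.
move=> u; have [a e] := range_val (val u).
by apply/val_inj/val_inj; rewrite (hf _ _ e) (hg _ _ e).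
Qed.

Lemma represents_ex q : G (plab q) ->
  exists f : smap (induced (dom_image q)) (induced (cod_image q)), represents q f.
Proof.
move=> Gq; have [Gp _ _ _] := psi_emb.
have [p [Gp' pp' _]] := lperm_inv Gp.
have /choice[f hf] : forall u : induced (dom_image q),
    exists v : induced (cod_image q),
      forall a, psi a = val (val u) -> val (val v) = psi (pfun q a).
  move=> u; have [a [qa e]] := dom_imageP u.
  have ra : range psi (psi (pfun q a)) by exists (pfun q a).
  have rc : cod_image q (SigSub (mem_set ra)) by exists a.
  by exists (SigSub (mem_set rc)) => b /=; rewrite -e => /psi_inj ->.
exists (SMap (lmap_comp (lmap_comp (lpart psi) (plab q)) p) f); split=> //=.
have [v [_ pv vp]] := lperm_inv Gp'.
suff -> : lpart psi = v by rewrite -lmap_compA pv lmap_comp1r.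
by rewrite -[lpart psi]lmap_comp1r -pv lmap_compA pp' lmap_comp1l.
Qed.

Lemma represents_pauto q U V (f : smap (induced U) (induced V)) :
  pauto q -> represents q f -> is_partial_aut G f.
Proof.
move=> [clq eq] [eU eV lf hf]; subst U V.
have [Gp _ _ pF] := psi_emb.
have sU : is_sub G (dom_image q).
  apply/(is_subP L_unary) => F x y [a qa ea] /= xy.
  have [F' eF] := lperm_on_fun F Gp.
  move: xy; rewrite -ea -eF -[[:: psi a]]/(map psi [:: a]) -pF => -[b ab eb].
  by exists b => //; exact: clq qa ab.
have [i ie ei] : exists2 i : smap (induced (dom_image q)) A,
    is_emb G i & smap_comp psi i = iota (dom_image q).
  by apply: lift_emb (iota_emb sU) _ => u; exact: range_val.
have iE u : psi (i u) = val (val u) by have := congr1 (fun g : smap _ _ => g u) ei.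
have qi u : pdom q (i u).
  by have [a [qa /esym]] := dom_imageP u; rewrite -iE => /psi_inj ->.
have ke := emb_on_comp L_unary ie qi eq.
have sV : is_sub G (cod_image q).
  apply/(is_subP L_unary) => F x y [a qa ea] /= xy.
  have [F' eF] := lperm_on_fun F Gp.
  move: xy; rewrite -ea -eF -[[:: psi (pfun q a)]]/(map psi [:: pfun q a]) -pF => -[b ab eb].
  have [Gq _ _ qF] := eq; have [F'' eF''] := lperm_on_fun F' Gq.
  move: ab; rewrite -eF'' -qF// => -[c ac ec].
  by exists c; [exact: clq qa ac|rewrite ec].
have fe : is_emb G f.
  apply: (is_emb_cancel (iota_emb sV)).
  rewrite (_ : smap_comp (iota (cod_image q)) f =
    smap_comp psi (SMap (lmap_comp (plab q) (lpart i)) (pfun q \o i))).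
    exact: is_emb_comp.
  apply: smap_eq => /=; last by move=> u /=; rewrite (hf u (i u)).
  have e : lmap_comp (lpart psi) (lpart i) = lmap_id L by have := congr1 (@lpart _ _ _) ei.
  have [Gi _ _ _] := ie.
  transitivity (lpart f); first by case: (lpart f).
  by rewrite lmap_compA -lf -lmap_compA e lmap_comp1r.
split=> //; split=> //.
have [_ fI _ _] := fe.
have /choice[g fg] : forall v : induced (cod_image q),
    exists u : induced (dom_image q), f u = v.
  move=> v; have [a qa ea] := set_mem (valP v).
  have ra : range psi (psi a) by exists a.
  have rd : dom_image q (SigSub (mem_set ra)) by exists a.
  exists (SigSub (mem_set rd)); apply/val_inj/val_inj.
  by rewrite (hf _ a) //= ea.
by exists g => // u; apply: fI; rewrite fg.
Qed.

Lemma partial_aut_represents U V (f : smap (induced U) (induced V)) :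
  is_partial_aut G f -> exists2 q, pauto q & represents q f.
Proof.
move=> [sU sV [fe [g fK gK]]]; have [Gp _ _ _] := psi_emb.
have [i ie ei] : exists2 i : smap (induced U) A, is_emb G i & smap_comp psi i = iota U.
  by apply: lift_emb (iota_emb sU) _ => u; exact: range_val.
have [j je ej] : exists2 j : smap (induced U) A,
    is_emb G j & smap_comp psi j = smap_comp (iota V) f.
  apply: lift_emb; first exact: is_emb_comp fe (iota_emb sV).
  by move=> u; exact: range_val.
have iE u : psi (i u) = val (val u) by have := congr1 (fun g : smap _ _ => g u) ei.
have jE u : psi (j u) = val (val (f u)) by have := congr1 (fun g : smap _ _ => g u) ej.
have [Gi iI _ _] := ie; have [Gj _ _ _] := je; have [Gf _ _ _] := fe.
have [i' [Gi' ii' i'i]] := lperm_inv Gi.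
have /choice[h hi] : forall a, exists b, forall u, i u = a -> b = j u.
  move=> a; have [[u ua]|nu] := pselect (exists u, i u = a).
    by exists (j u) => v; rewrite -ua => /iI ->.
  by exists a => v va; case: nu; exists v.
have hE u : h (i u) = j u by exact: hi.
pose q := PMap (range i) h (lmap_comp (lpart j) i').
have qj : lmap_comp (plab q) (lpart i) = lpart j.
  by rewrite /= -lmap_compA i'i lmap_comp1r.
have rep : represents q f; last exists q => //.
  have e : lmap_comp (lpart psi) (lpart i) = lmap_id L by have := congr1 (@lpart _ _ _) ei.
  have e' : lmap_comp (lpart psi) (lpart j) = lpart f.
    have := congr1 (@lpart _ _ _) ej => /= ->; by case: (lpart f).
  split=> /=.
  - apply/seteqP; split=> [z Uz|z [a [u _ <-]]].
      pose u : induced U := SigSub (mem_set Uz).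
      by exists (i u); [exists u|rewrite iE].
    by rewrite iE => /val_inj <-; exact: set_mem (valP u).
  - apply/seteqP; split=> [z Vz|z [a [u _ <-]]].
      pose v : induced V := SigSub (mem_set Vz).
      by exists (i (g v)); [exists (g v)|rewrite /= hE jE gK].
    by rewrite /= hE jE => /val_inj <-; exact: set_mem (valP (f u)).
  - apply: (lperm_cancel_r Gi).
    by rewrite -!lmap_compA i'i e !lmap_comp1r e'.
  - by move=> u a; rewrite -iE => /psi_inj ->; rewrite /= hE jE.
split; first exact: closed_range ie.
by apply: (emb_on_factor ie je).
Qed.

Lemma represents_dom q U V (f : smap (induced U) (induced V)) : represents q f ->
  forall a, pdom q a <-> exists u : induced U, val (val u) = psi a.
Proof.
move=> [eU _ _ _] a; subst U; split=> [qa|[u ua]].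
  have ra : range psi (psi a) by exists a.
  have rd : dom_image q (SigSub (mem_set ra)) by exists a.
  by exists (SigSub (mem_set rd)).
by have [b [qb]] := dom_imageP u; rewrite ua => /psi_inj <-.
Qed.

Lemma represents_comp q1 q2 q3 U V W (f : smap (induced U) (induced V))
    (g : smap (induced V) (induced W)) :
  represents q1 f -> represents q2 g -> represents q3 (smap_comp g f) ->
  pcomposite q1 q2 q3.
Proof.
move=> r1 r2 r3; have [Gp _ _ _] := psi_emb.
have [eU eV l1 h1] := r1; have [_ _ l2 h2] := r2; have [_ _ l3 h3] := r3.
split.
- by move=> a; split=> [/(represents_dom r3)|/(represents_dom r1)] h;
    [apply/(represents_dom r1)|apply/(represents_dom r3)].
- move=> b; split=> [/(represents_dom r2)[v vb]|[a /(represents_dom r1)[u ua] <-]].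
    have VV : V `<=` cod_image q1 by rewrite -eV.
    by have [a qa] := VV _ (set_mem (valP v)); rewrite vb => /psi_inj ab; exists a.
  by apply/(represents_dom r2); exists (f u); exact: h1.
- move=> a /(represents_dom r1)[u ua]; apply: psi_inj.
  by rewrite -(h3 u)//= -(h2 (f u)) // -(h1 u).
- apply: (lperm_cancel_l Gp); rewrite -l3 /= -lmap_compA l1 lmap_compA l2.
  by rewrite lmap_compA.
Qed.

Lemma comp_represents q1 q2 q3 U V W (f : smap (induced U) (induced V))
    (g : smap (induced V) (induced W)) :
  represents q1 f -> represents q2 g -> pcomposite q1 q2 q3 ->
  represents q3 (smap_comp g f).
Proof.
move=> r1 r2 [c1 c2 c3 c4].
have [eU eV l1 h1] := r1; have [eV' eW l2 h2] := r2.
split=> /=.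
- by rewrite eU; apply/seteqP; split=> z [a /c1 qa az]; exists a.
- rewrite eW; apply/seteqP; split=> z [a].
    by move=> /c2[b qb <-] bz; exists b; [exact/c1|rewrite c3].
  by move=> /c1 qa az; exists (pfun q1 a); [apply/c2; exists a|rewrite -c3].
- by rewrite -lmap_compA l1 lmap_compA l2 c4.
- move=> u a au; rewrite (h2 _ (pfun q1 a)) ?c3// -?(h1 u)//.
  by apply/(represents_dom r1); exists u.
Qed.

End Represent.

Lemma witness_intro (coh : Prop) A B :
    finite_structure A -> finite_structure B -> is_witness coh A B ->
  EPPA_witness G A B /\ (coh -> coherent_EPPA_witness G A B).
Proof.
move=> fA fB [psi [hat [pe hat_aut hat_ext hat_comp]]].
have [Gp pI _ _] := pe.
have ext q (U V : set (image_structure psi)) (f : smap (induced U) (induced V)) :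
    pauto q -> represents q f -> extends_in f (hat q).
  move=> pq rq; have [_ _ lf hf] := rq; have [lh hh] := hat_ext q pq.
  split; first by apply: (lperm_cancel_r Gp); rewrite lh lf.
  move=> u; have [a au] := range_val (val u).
  by rewrite (hf u a)// -au hh//; apply/(represents_dom pe rq); exists u.
split.
  split=> //; exists psi => // U V f pf.
  have [q pq rq] := partial_aut_represents pe pf.
  by exists (hat q) => //; exact: ext.
move=> c; split=> //; exists psi => //.
pose represented (U V : set (image_structure psi)) (f : smap (induced U) (induced V)) :=
  exists q, pauto q /\ represents q f.
pose hat0 (U V : set (image_structure psi)) (f : smap (induced U) (induced V)) :=
  if pselect (represented U V f) is left h then hat (projT1 (cid h)) else SMap (lmap_id L) id.
have hat0P (U V : set (image_structure psi)) (f : smap (induced U) (induced V)) :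
    is_partial_aut G f -> exists q, [/\ pauto q, represents q f & hat0 U V f = hat q].
  move=> pf; have [q pq rq] := partial_aut_represents pe pf; rewrite /hat0.
  case: pselect => [h|[]]; last by exists q.
  by case: cid => /= q' [pq' rq']; exists q'.
exists hat0; split=> [U V f pf|U V W f g pf pg].
  have [q [pq rq ->]] := hat0P U V f pf; split=> //; exact: ext.
have [q1 [pq1 r1 ->]] := hat0P _ _ _ pf; have [q2 [pq2 r2 ->]] := hat0P _ _ _ pg.
have pgf : is_partial_aut G (smap_comp g f).
  have [sU sV [fe fb]] := pf; have [_ sW [ge gb]] := pg.
  by split=> //; split; [exact: is_emb_comp|exact: bij_comp].
have [q3 [pq3 r3 ->]] := hat0P _ _ _ pgf.
by apply: hat_comp => //; exact: (represents_comp pe r1 r2 r3).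
Qed.

Lemma witness_of_extensions (coh : Prop) A B (psi : smap A B)
    (hat0 : forall U V : set (image_structure psi), smap (induced U) (induced V) -> smap B B) :
    is_emb G psi ->
    (forall U V (f : smap (induced U) (induced V)), is_partial_aut G f ->
       is_aut G (hat0 U V f) /\ extends_in f (hat0 U V f)) ->
    (coh -> forall U V W (f : smap (induced U) (induced V)) (g : smap (induced V) (induced W)),
       is_partial_aut G f -> is_partial_aut G g ->
       hat0 U W (smap_comp g f) = smap_comp (hat0 V W g) (hat0 U V f)) ->
  is_witness coh A B.
Proof.
move=> pe h0 hcomp.
have /choice[hat hatP] : forall q : pmap A, exists theta : smap B B, is_aut G theta /\
    (pauto q -> exists f : smap (induced (@dom_image _ _ psi q)) (induced (@cod_image _ _ psi q)),
      represents q f /\ theta = hat0 _ _ f).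
  move=> q; have [pq|npq] := pselect (pauto q); last first.
    by exists (SMap (lmap_id L) id); split; first exact: is_aut_id.
  have [_ [Gq _ _ _]] := pq; have [f rf] := represents_ex pe Gq.
  exists (hat0 _ _ f); split; last by move=> _; exists f.
  by have [] := h0 _ _ f (represents_pauto pe pq rf).
have hatE q (U V : set (image_structure psi)) (f : smap (induced U) (induced V)) :
    pauto q -> represents q f -> hat q = hat0 _ _ f.
  move=> pq rf; have [_ /(_ pq)[f' [rf' ->]]] := hatP q.
  have [eU eV _ _] := rf; subst U V.
  by congr hat0; exact: (represents_uniq pe rf' rf).
exists psi, hat; split=> //.
- by move=> q; have [] := hatP q.
- move=> q pq; have [_ [Gq _ _ _]] := pq; have [f rf] := represents_ex pe Gq.
  rewrite (hatE q _ _ f)//; have [_ [lf hf]] := h0 _ _ f (represents_pauto pe pq rf).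
  have [_ _ l1 h1] := rf.
  rewrite lf; split=> // a /(represents_dom pe rf)[u ua].
  by rewrite -ua hf (h1 u a).
move=> c q1 q2 q3 p1 p2 p3 comp12.
have [_ [G1 _ _ _]] := p1; have [_ [G2 _ _ _]] := p2.
have [f rf] := represents_ex pe G1.
have [g rg] : exists g : smap (induced (@cod_image _ _ psi q1)) (induced (@cod_image _ _ psi q2)),
    represents q2 g.
  have -> : @cod_image _ _ psi q1 = @dom_image _ _ psi q2; last exact: represents_ex.
  have [_ c2 _ _] := comp12.
  apply/seteqP; split=> z [a qa az].
    by exists (pfun q1 a) => //; apply/c2; exists a.
  by have /c2[b qb ba] := qa; exists b; rewrite ?ba.
rewrite (hatE q1 _ _ f)// (hatE q2 _ _ g)//.
rewrite (hatE q3 _ _ (smap_comp g f))//; last exact: (comp_represents pe rf rg).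
apply: hcomp => //; [exact: (represents_pauto pe p1)|exact: (represents_pauto pe p2)].
Qed.

Lemma EPPA_is_witness A B : EPPA_witness G A B -> is_witness False A B.
Proof.
move=> [fA fB [psi pe h]].
apply: (@witness_of_extensions _ _ _ psi (fun U V f =>
  if pselect (is_partial_aut G f) is left pf then projT1 (cid2 (h U V f pf))
  else SMap (lmap_id L) id)) => // U V f pf.
by case: pselect => // pf'; case: cid2.
Qed.

Lemma coherent_EPPA_is_witness A B : coherent_EPPA_witness G A B -> is_witness True A B.
Proof.
move=> [fA fB [psi pe [hat [h1 h2]]]].
by apply: (@witness_of_extensions _ _ _ psi hat) => // _; exact: h2.
Qed.

End Witness.

(** * Structures on the systems *)

Section MoreEmb.
Variable L : language.
Variable G : lperm_group L.
Implicit Types (A B C D : structure L).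

Lemma emb_on_trans B C D (U : set B) (V : set C) (g : B -> C) (h : C -> D) s s' :
    emb_on G U g s -> (forall x, U x -> V (g x)) -> emb_on G V h s' ->
  emb_on G U (h \o g) (lmap_comp s' s).
Proof.
move=> [Gs gI gR gF] UV [Gs' hI hR hF]; split=> /=.
- exact: lpg_comp.
- by move=> x y Ux Uy /= /(hI _ _ (UV _ Ux) (UV _ Uy))/gI; apply.
- move=> R x Ux; rewrite (gR R x Ux) map_comp; apply: hR.
  by apply/within_map; apply: within_mono Ux; exact: UV.
- by move=> F x Ux; rewrite -image_comp gF// hF//; exact: UV.
Qed.

Lemma emb_on_eq B C (U V : set B) (g g' : B -> C) s : closed_set V -> U `<=` V ->
  (forall x, V x -> g x = g' x) -> emb_on G U g s -> emb_on G U g' s.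
Proof.
move=> clV UV e [Gs gI gR gF]; split=> //.
- by move=> x y Ux Uy; rewrite -!e; [exact: gI|exact: UV|exact: UV].
- move=> R x Ux; rewrite gR//.
  suff -> : map g x = map g' x by [].
  by elim: x Ux => //= x t IH [/UV/e -> /IH ->].
- move=> F x Ux; rewrite -e; last exact: UV.
  rewrite -gF//; apply/seteqP; split=> _ [y xy <-]; exists y => //.
    by apply: e; apply: clV xy; exact: UV.
  by apply/esym/e; apply: clV xy; exact: UV.
Qed.

Lemma emb_on_sub B C (U V : set B) (g : B -> C) s : U `<=` V ->
  emb_on G V g s -> emb_on G U g s.
Proof.
move=> UV [Gs gI gR gF]; split=> //.
- by move=> x y /UV Vx /UV; apply: gI.
- by move=> R x Ux; apply: gR; apply: within_mono Ux; exact: UV.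
- by move=> F x /UV; exact: gF.
Qed.

End MoreEmb.

Section Model.
Variable L : language.
Hypothesis L_unary : forall F : fun_sym L, fun_arity F = 1.
Variable G : lperm_group L.
Variables (A B0 : structure L) (P : Type) (dom : P -> A -> Prop) (ap : P -> A -> A).
Implicit Types (X Y Z : system dom ap) (C D : structure L).

(** What remains of the link with [B0] on covers of the system of copies:
edges are mapped injectively into copies of [A], and closures are both
generated by the functions of [B0] and complete for them. *)
Record is_model X (p : X -> B0) : Prop := IsModel {
  model_inj : forall E, E \in edges X -> {in E &, injective p};
  model_edge : forall E, E \in edges X ->
    exists2 phi : smap A B0, is_emb G phi & forall x, x \in E -> range phi (p x);
  model_fun : forall F x z, fun_in F [:: p x] z -> exists2 y, y \in cl x & p y = z;
  model_cl : forall x y, y \in cl x ->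
    forall W : set B0, closed_set W -> W (p x) -> W (p y) }.

Lemma model_cover X Y (f : Y -> X) (p : X -> B0) :
  is_cover f -> is_model p -> is_model (p \o f).
Proof.
move=> fc [m1 m2 m3 m4]; split.
- move=> C CY x y xC yC /= e; apply: (cover_inj fc CY) => //.
  by apply: (m1 _ (cover_edge fc CY)) => //; apply: imset_f.
- move=> C CY; have [phi pe ph] := m2 _ (cover_edge fc CY).
  by exists phi => // x xC; apply/ph/imset_f.
- move=> F x z /m3[y]; rewrite -(cover_cl fc) => /imsetP[u ux ->] <-.
  by exists u.
- by move=> x y yx; apply: m4; rewrite -(cover_cl fc) imset_f.
Qed.

Section Struct.
Variables (X : system dom ap) (p : X -> B0).

Definition model_rel (R : rel_sym L) : set (seq X) :=
  [set t | face [set x in t]%SET /\ rel_in R (map p t)].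

Definition model_op (F : fun_sym L) (t : seq X) : set X :=
  if t is [:: x] then [set y | y \in cl x /\ fun_in F [:: p x] (p y)] else set0.

Lemma model_countable : countable [set: X].
Proof. exact/finite_set_countable/finite_finset. Qed.

Lemma model_rel_size R t : model_rel R t -> size t = rel_arity R.
Proof. by move=> [_ /rel_in_size]; rewrite size_map. Qed.

Lemma model_op_size F t : size t <> fun_arity F -> model_op F t = set0.
Proof. by rewrite L_unary; case: t => [|x [|]]. Qed.

(** The structure of [B0] is lifted along [p]: relations hold only inside
edges, and the values of functions at [x] are lifted to the closure of [x]. *)
Definition model_struct : structure L :=
  Struct model_countable model_rel_size model_op_size.

End Struct.

(** The combinatorial form of a homomorphism-embedding: the irreducible
substructures lie in cliques ([irreducible_clique]). *)
Definition clique_emb X (p : X -> B0) (U : {set X}) C (g : X -> C) (s : lmap L) : Prop :=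
  G s /\ forall K : {set X}, K \subset U -> clique K ->
    @emb_on L G (model_struct p) C [set` K] g s.

Definition completable (K : structure L -> Prop) X (p : X -> B0) (U : {set X}) : Prop :=
  exists (C : structure L) (g : X -> C) s, K C /\ clique_emb p U g s.

Lemma closed_setE X (p : X -> B0) (U : {set X}) :
  closed U -> @closed_set L (model_struct p) [set` U].
Proof. by move=> /closedP cU F x y xU [yx _]; exact: (fintype.subsetP (cU x xU)). Qed.

Lemma within_subset X (U : {set X}) (t : seq X) :
  within [set` U] t -> ([set x in t]%SET \subset U).
Proof.
move=> Ut; apply/fintype.subsetP => x; rewrite inE.
by elim: t Ut => //= y t IH [yU /IH tU]; rewrite inE => /orP[/eqP->|].
Qed.

Lemma within_self X (t : seq X) : within [set` [set x in t]%SET] t.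
Proof.
suff : within (fun x => x \in t) t by apply: within_mono => x xt; rewrite /= inE.
elim: t => //= x t IH; split; first exact: mem_head.
by apply: within_mono IH => y yt; rewrite inE yt orbT.
Qed.

Lemma face_sub X (M M' : {set X}) : M' \subset M -> face M -> face M'.
Proof.
by move=> s /faceP[C CX MC]; apply/faceP; exists C => //; exact: fintype.subset_trans s MC.
Qed.

Lemma face_emb X (p : X -> B0) (M : {set X}) : is_model p -> face M ->
  @emb_on L G (model_struct p) B0 [set` M] p (lmap_id L).
Proof.
move=> [m1 m2 m3 m4] fM; have /faceP[C CX /fintype.subsetP MC] := fM; split.
- exact: lpg_id.
- by move=> x y /MC xC /MC yC; exact: (m1 C).
- move=> R t Mt; split=> [[]//|pt]; split=> //.
  exact: face_sub (within_subset Mt) fM.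
- move=> F x xM; apply/seteqP; split=> [_ [y [_ xy] <-]//|z xz].
  by have [y yx e] := m3 _ _ _ xz; exists y => //; split=> //; rewrite e.
Qed.

(** A face is mapped by [p] into a copy of [A], so a structure that lives on a
face embeds into [A]. *)
Lemma face_lift X (p : X -> B0) (M : {set X}) D (v : D -> X) : is_model p -> face M ->
    is_emb G (@SMap L D (model_struct p) (lmap_id L) v) -> (forall d, v d \in M) ->
  exists i : smap D A, is_emb G i.
Proof.
move=> pm fM ve vM; have /faceP[C CX /fintype.subsetP MC] := fM.
have [phi pe ph] := model_edge pm CX.
have je := emb_on_comp L_unary ve vM (face_emb pm fM).
have /choice[i hi] : forall d, exists a, phi a = p (v d).
  by move=> d; have [a _ e] := ph _ (MC _ (vM d)); exists a.
have [Gp _ _ _] := pe; have [Gj _ _ _] := je.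
have [s [Gs e]] := lperm_quotient Gp Gj.
exists (SMap s i); apply: (is_emb_cancel pe).
by rewrite (_ : smap_comp _ _ = SMap (lmap_comp (lmap_id L) (lmap_id L)) (p \o v))//;
  apply: smap_eq => //= d; rewrite hi.
Qed.

Lemma inclusion_emb X (p : X -> B0) (M : {set X}) : closed M ->
  is_emb G (@SMap L (induced (A := model_struct p) [set` M]) (model_struct p)
    (lmap_id L) val).
Proof. by move=> cM; apply/(is_subP L_unary)/closed_setE. Qed.

Lemma face_completable K X (p : X -> B0) (M : {set X}) (a0 : A) : K A -> is_model p ->
  closed M -> face M -> completable K p M.
Proof.
move=> KA pm cM fM; have ie := inclusion_emb p cM.
have [i ii] := face_lift pm fM ie (fun d => set_mem (valP d)).
have /choice[g hg] : forall x : X, exists a, forall u : induced (A := model_struct p) [set` M],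
    val u = x -> a = i u.
  move=> x; have [xM|xM] := boolP (x \in M).
    have Mx : [set` M] x := xM.
    exists (i (SigSub (mem_set Mx))) => u ux.
    by congr (i _); apply: val_inj; rewrite ux.
  by exists a0 => u ux; move: xM; rewrite -ux (set_mem (valP u)).
have [Gi _ _ _] := ii.
exists A, g, (lpart i); split=> //; split=> // S SM cS.
have := emb_on_factor ie ii (fun u => hg _ u erefl) (lmap_comp1r _).
apply: emb_on_sub => x xS.
have Mx : [set` M] x := fintype.subsetP SM x xS.
by exists (SigSub (mem_set Mx)).
Qed.

(** In conformal systems a clique and its image are both in edges, where the
two structures are copied from [B0] by compatible maps. *)
Lemma cover_emb X Y (f : Y -> X) (p : X -> B0) (q : Y -> B0) (M : {set Y}) :
    is_cover f -> q =1 p \o f -> conformal X -> conformal Y -> clique M ->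
  @emb_on L G (model_struct q) (model_struct p) [set` M] f (lmap_id L).
Proof.
move=> fc e cX cY cM; split.
- exact: lpg_id.
- exact: cover_clique_inj fc M cM.
- move=> R t Mt; rewrite /= /model_rel /= -map_comp -(eq_map e).
  have ft : face [set x in t]%SET := face_sub (within_subset Mt) (cY _ cM).
  suff ff : face [set x in map f t]%SET by split=> -[].
  apply: cX; rewrite (_ : [set x in map f t]%SET = f @: [set x in t]%SET).
    exact: (cover_clique fc) (face_clique ft).
  apply/setP => x; rewrite inE; apply/mapP/imsetP => -[u]; rewrite ?inE => ut ->.
    by exists u; rewrite ?inE.
  by exists u => //; rewrite inE in ut.
- move=> F x xM /=; apply/seteqP; split=> [_ [y [yx xy] <-]|z [zx xz]] /=.
    by split; [rewrite -(cover_cl fc) imset_f|have := xy; rewrite !e].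
  move: zx xz; rewrite -(cover_cl fc) => /imsetP[y yx ->] xy.
  by exists y => //; split=> //; rewrite !e.
Qed.

Lemma completable_pullback K X Y (f : Y -> X) (p : X -> B0) (q : Y -> B0) (M : {set Y}) :
    is_cover f -> q =1 p \o f -> conformal X -> conformal Y ->
  completable K p (f @: M) -> completable K q M.
Proof.
move=> fc e cX cY [C [g [s [KC [Gs gs]]]]].
exists C, (g \o f), (lmap_comp s (lmap_id L)); split=> //; split.
  by rewrite lmap_comp1r.
move=> S SM cS; apply: emb_on_trans (cover_emb fc e cX cY cS) _ (gs (f @: S) _ _).
- by move=> x xS; apply: imset_f.
- exact: imsetS.
- exact: cover_clique.
Qed.

Lemma In_mem_map D X (v : D -> X) (d : D) t : List.In d t -> v d \in map v t.
Proof. by elim: t => //= x t IH [->|/IH h]; rewrite inE ?eqxx// h orbT. Qed.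

(** If [v d] and [v d'] are not adjacent, [D] is the free amalgam of the
points whose closure misses [v d] and of those whose closure misses [v d'].  A
tuple in a relation that meets both complements would lie in an edge containing
[v d] and [v d']. *)
Lemma irreducible_clique X (p : X -> B0) D (v : D -> X) :
    is_emb G (@SMap L D (model_struct p) (lmap_id L) v) -> (forall d, adj (v d) (v d)) ->
  irreducible G D -> forall d d', adj (v d) (v d').
Proof.
move=> [_ vI vR vF] vv irr d d'; case: (boolP (adj (v d) (v d'))) => // nadj.
exfalso; apply: irr.
pose far (x : X) : set D := [set z | x \notin cl (v z)].
have far_sub x : is_sub G (far x).
  apply/(is_subP L_unary) => F z w; rewrite /far /= => nz zw; apply: contra nz => xw.
  have [wz _] : model_op p F [:: v z] (v w) := eq_ind _ (fun S : set X => S (v w))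
    (ex_intro2 _ _ w zw erefl) _ (vF F [:: z]).
  exact: (fintype.subsetP (cl_trans wz)).
have near_adj z w : v d \in cl (v z) -> v d' \in cl (v w) -> adj (v z) (v w) -> False.
  move=> h1 h2 zw; move/negP: nadj; apply.
  by rewrite (adj_cl _ h2)// adj_sym (adj_cl _ h1)// adj_sym.
exists (far (v d)), (far (v d')), (far (v d) `&` far (v d')).
exists (@subIsetl _ _ _), (@subIsetr _ _ _).
have sub0 : is_sub G (far (v d) `&` far (v d')).
  have /(is_subP L_unary) c1 := far_sub (v d).
  have /(is_subP L_unary) c2 := far_sub (v d').
  by apply/(is_subP L_unary) => F x y [h1 h2] xy; split; [exact: c1 h1 xy|exact: c2 h2 xy].
have neT x : far (v x) <> setT.
  move=> e; have : far (v x) x by rewrite e.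
  by rewrite /far /= cl_refl_adj.
have inE1 (U : set D) (z : D) : U z -> range (inclusion U) z.
  by move=> Uz; exists (SigSub (mem_set Uz)).
split=> //; split.
- split; first by split; [exact: far_sub|exact: far_sub|exact: smap_eq].
  apply/seteqP; split=> [z [[[u hu] _ <-] [[u' hu'] _ e]]|z [u _ <-]] /=.
    move: e => /= e; subst u'.
    have uU := conj (set_mem hu) (set_mem hu').
    by exists (SigSub (mem_set (uU : (far (v d) `&` far (v d')) u))).
  have [h1 h2] := set_mem (valP u).
  by split; exact: inE1.
- apply/seteqP; split=> // z _.
  have [h|h] := boolP (v d \in cl (v z)); last by left; exact: inE1.
  right; apply: inE1; rewrite /far /=; apply/negP => h'.
  exact: near_adj h h' (vv z).
move=> t [y1 ty1 [u1 hu1 e1]] [y2 ty2 [u2 hu2 e2]].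
have far1 : v d' \in cl (v y1).
  apply/negPn/negP => h; apply: hu1.
  have uU : (far (v d) `&` far (v d')) (val u1).
    by split; [exact: set_mem (valP u1)|move: h; rewrite -e1].
  by exists (SigSub (mem_set uU)) => //; apply: val_inj.
have far2 : v d \in cl (v y2).
  apply/negPn/negP => h; apply: hu2.
  have uU : (far (v d) `&` far (v d')) (val u2).
    by split; [move: h; rewrite -e2|exact: set_mem (valP u2)].
  by exists (SigSub (mem_set uU)) => //; apply: val_inj.
split=> [R /vR [/faceP[C CX /fintype.subsetP tC] _]|F].
  apply: (near_adj y2 y1) => //; apply/adjP; exists C; split=> //; apply: tC; rewrite inE.
    exact: (In_mem_map v ty2).
  exact: (In_mem_map v ty1).
rewrite -subset0 => y ty; have [x0 tx] := fun_in_unary L_unary ty; subst t.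
move: ty1 ty2 => /= [e1'|//] [e2'|//].
by move: far1 far2; rewrite -e1' -e2' => far1 far2; case: (near_adj _ _ far2 far1 (vv x0)).
Qed.

Lemma irreducible_image X (p : X -> B0) D (v : D -> X) :
    is_emb G (@SMap L D (model_struct p) (lmap_id L) v) -> (forall d, adj (v d) (v d)) ->
    irreducible G D ->
  exists S : {set X}, [/\ clique S, forall d, v d \in S
    & forall x, x \in S -> exists d, v d = x].
Proof.
move=> ve vv irr; have cD := irreducible_clique ve vv irr.
pose S : {set X} := [set x | `[< exists d, v d = x >]]%SET.
have SE x : x \in S -> exists d, v d = x by rewrite [x \in S]inE => h; apply/asboolP.
exists S; split=> // [|d]; first by apply/cliqueP => x y /SE[u <-] /SE[u' <-]; exact: cD.
by rewrite [_ \in S]inE; apply/asboolP; exists d.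
Qed.

(** The closure operator of the system is generated by the functions, because
the part of the closure of [x] inside [M] projects to a closed set of [B0]. *)
Lemma closed_of_closed_set X (p : X -> B0) (M : {set X}) : is_model p ->
    {in M, forall x, adj x x} -> @closed_set L (model_struct p) [set` M] -> closed M.
Proof.
move=> [m1 m2 m3 m4] rM cM; apply/closedP => x xM; apply/fintype.subsetP => y yx.
have [C [CX xC _]] := adjP _ _ (rM x xM).
have [z [zM zx] zy] : (p @` [set z | z \in M /\ z \in cl x]) (p y).
  apply: (m4 x y yx); last by exists x => //; split=> //; exact: cl_refl_adj (rM x xM).
  move=> F _ b [z [zM zx] <-] /[dup] zb /m3[u uz ub]; exists u => //; split.
    by apply: (cM F z u zM); split=> //; rewrite ub.
  exact: (fintype.subsetP (cl_trans zx)).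
suff <- : z = y by [].
have xCs := fintype.subsetP (edge_cl CX xC).
by apply: (m1 C CX) => //; exact: xCs.
Qed.

Lemma clique_emb_hom_emb X (p : X -> B0) (U : {set X}) C (g : X -> C) s D (v : D -> X) :
    is_emb G (@SMap L D (model_struct p) (lmap_id L) v) ->
    (forall d, v d \in U) -> (forall d, adj (v d) (v d)) -> clique_emb p U g s ->
  is_hom_emb G (@SMap L D C s (g \o v)).
Proof.
move=> ve vU vv [Gs gs]; have [_ vI vR vF] := ve.
have imU (t : seq D) : [set x in map v t]%SET \subset U.
  apply/fintype.subsetP => x; rewrite [x \in finset _]inE.
  by elim: t => //= d t IH; rewrite in_cons => /orP[/eqP->|].
split.
  split=> //= [R t /vR [ft rt]|F t _ [y ty <-]].
    have [_ _ gR _] := gs _ (imU t) (face_clique ft).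
    rewrite map_comp -gR //.
    exact: within_self.
  have [x0 tx] := fun_in_unary L_unary ty; subst t.
  have cl1 : clique [set v x0]%SET.
    by apply/cliqueP => a b; rewrite !inE => /eqP-> /eqP->.
  have subU : [set v x0]%SET \subset U by rewrite finset.sub1set.
  have [_ _ _ gF] := gs [set v x0]%SET subU cl1.
  have {}gF := gF F (v x0) (set11 _).
  rewrite /= -gF; exists (v y) => //.
  exact: (eq_ind _ (fun S : set X => S (v y)) (ex_intro2 _ _ y ty erefl) _ (vF F [:: x0])).
move=> W sW irr.
have we : is_emb G (@SMap L (induced W) (model_struct p) (lmap_id L) (v \o val)).
  exact: is_emb_comp sW ve.
have [S [cS SP SE]] := irreducible_image we (fun u => vv _) irr.
have SU : S \subset U by apply/fintype.subsetP => x /SE[u <-]; exact: vU.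
exact: (emb_on_comp L_unary we SP (gs S SU cS)).
Qed.

End Model.

(** * Mapping small sets to the class by amalgamation *)

Section Good.
Variable L : language.
Hypothesis L_unary : forall F : fun_sym L, fun_arity F = 1.
Variable G : lperm_group L.
Variables (A B0 : structure L) (P : Type) (dom : P -> A -> Prop) (ap : P -> A -> A).
Implicit Types (X Y Z : system dom ap) (C D : structure L).
Variable K : structure L -> Prop.
Hypothesis K_hereditary : hereditary G K.
Hypothesis K_amalg : strong_amalgamation_property G K.
Hypothesis KA : K A.
Variable a0 : A.

(** The common part lies in a copy of [A], so it is in [K] by heredity, and
the two maps restrict to embeddings of it.  Amalgamate their targets over it; since
each clique lies on one side, the union of the two maps is an embedding on
cliques. *)
Lemma completable_amalgam X (p : X -> B0) (W U1 U2 : {set X}) :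
    is_model G p -> closed U1 -> closed U2 -> U1 :|: U2 = W -> face (U1 :&: U2)%SET ->
    (forall S : {set X}, S \subset W -> clique S -> S \subset U1 \/ S \subset U2) ->
    completable L_unary G K p U1 -> completable L_unary G K p U2 ->
  completable L_unary G K p W.
Proof.
move=> pm c1 c2 UW f0 hS [C1 [g1 [s1 [K1 [Gs1 h1]]]]] [C2 [g2 [s2 [K2 [Gs2 h2]]]]].
pose U0 := (U1 :&: U2)%SET.
have c0 : closed U0.
  apply/closedP => x; rewrite !inE => /andP[x1 x2].
  by rewrite finset.subsetI (closedP _ c1 x x1) (closedP _ c2 x x2).
have U0P (u : induced (A := model_struct L_unary p) [set` U0]) : val u \in U0.
  exact: set_mem (valP u).
have ie := inclusion_emb L_unary G p c0.
have cl0 := face_clique f0.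
have sub1 : U0 \subset U1 by exact: finset.subsetIl.
have sub2 : U0 \subset U2 by exact: finset.subsetIr.
have e1 := emb_on_comp L_unary ie U0P (h1 _ sub1 cl0).
have e2 := emb_on_comp L_unary ie U0P (h2 _ sub2 cl0).
have K0 : K (induced (A := model_struct L_unary p) [set` U0]).
  have [i ii] := face_lift pm f0 ie U0P.
  exact: K_hereditary KA ii.
have [C [b1 [b2 [KC [[b1e b2e b12] _]]]]] := K_amalg K0 K1 K2 e1 e2.
have b12E (u : induced (A := model_struct L_unary p) [set` U0]) :
    b1 (g1 (val u)) = b2 (g2 (val u)).
  exact: (congr1 (fun f => vpart f u) b12).
pose g x := if x \in U1 then b1 (g1 x) else b2 (g2 x).
have gg x : x \in U2 -> b2 (g2 x) = g x.
  move=> x2; rewrite /g; case: ifP => // x1.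
  have x0 : [set` U0] x by rewrite /= inE x1 x2.
  by have := b12E (SigSub (mem_set x0)).
have s12 : lmap_comp (lpart b1) s1 = lmap_comp (lpart b2) s2.
  have := congr1 (@lpart _ _ _) b12; rewrite /= !lmap_compA.
  by rewrite !lmap_comp1r.
have [Gb1 _ _ _] := b1e.
exists C, g, (lmap_comp (lpart b1) s1); split=> //; split; first exact: lpg_comp.
move=> S SW cS; have [S1|S2] := hS S SW cS.
  have e := emb_on_trans (h1 S S1 cS) (V := setT) (fun=> fun=> I) (is_emb_emb_on _ b1e).
  apply: (@emb_on_eq L G (model_struct L_unary p) C [set` S] [set` U1] _ g _ _ _ _ e).
    exact: closed_setE.
    by move=> x; exact: (fintype.subsetP S1).
  by move=> x /= x1; rewrite /g x1.
rewrite s12.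
have e := emb_on_trans (h2 S S2 cS) (V := setT) (fun=> fun=> I) (is_emb_emb_on _ b2e).
apply: (@emb_on_eq L G (model_struct L_unary p) C [set` S] [set` U2] _ g _ _ _ _ e).
  exact: closed_setE.
  by move=> x; exact: (fintype.subsetP S2).
exact: gg.
Qed.

(** Cut along clique separators until the pieces are cliques, which embed
into [A]. *)
Lemma completable_trivializes X (p : X -> B0) (W : {set X}) :
    is_model G p -> conformal X -> trivializes W -> closed W ->
    {in W, forall x, adj x x} ->
  completable L_unary G K p W.
Proof.
move=> pm cX; have [n] := ubnP #|W|; elim: n W => // n IH W lt tW cW rW.
case: (boolP (clique W)) => [/cX fW|nW]; first exact: face_completable.
have [U1 [U2 [[c1 p1] [c2 p2] UW f0 hS]]] := clique_separator cX tW cW rW nW.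
have h U : closed U -> U \proper W -> completable L_unary G K p U.
  move=> cU pU; have sU := proper_sub pU; apply: IH => //.
  - by apply: leq_trans (proper_card pU) _; rewrite -ltnS.
  - exact: trivializes_sub sU tW.
  - by move=> x xU; apply: rW; exact: (fintype.subsetP sU).
exact: (completable_amalgam pm c1 c2 UW f0 hS (h _ c1 p1) (h _ c2 p2)).
Qed.

Lemma completable_cover X (p : X -> B0) n : is_model G p ->
  exists (Y : system dom ap) (f : Y -> X), [/\ is_cover f, conformal Y
    & forall M : {set Y}, #|M| <= n -> closed M -> {in M, forall x, adj x x} ->
      completable L_unary G K (p \o f) M].
Proof.
move=> pm; have [X' [f' [fc' cX']]] := conformal_cover X.
have [Y [f [fc cY hY]]] := treelike_cover n cX'.
exists Y, (f' \o f); split=> //; first exact: cover_trans fc fc'.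
move=> M Mn cM rM; have [Z [g [h [gc hc e cZ tZ]]]] := hY M Mn.
have pmZ : is_model G (p \o (f' \o h)) by apply: model_cover pm; exact: cover_trans hc fc'.
apply: (completable_pullback (p := p \o (f' \o h)) gc) => //.
  by move=> x /=; rewrite e.
apply: completable_trivializes => //; first exact: cover_closed.
by move=> _ /imsetP[x xM ->]; apply: (cover_adj gc); exact: rM.
Qed.

End Good.

(** * The system of copies in an EPPA-witness *)

Lemma finite_set_finType (T : Type) (t0 : T) : finite_set [set: T] ->
  exists (F : finType) (e : F -> T) (e' : T -> F), cancel e e' /\ cancel e' e.
Proof.
move=> /finite_setP[n]; case: n => [|n Tn].
  by rewrite II0 card_eq0 => /eqP /seteqP[] /(_ t0 I).
pose I : pointedType := HB.pack 'I_n.+1 (isPointed.Build 'I_n.+1 ord0).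
have /(@card_set_bijP _ I) [f] := card_eq_trans Tn card_II.
by rewrite setTT_bijective => -[g fg gf]; exists 'I_n.+1, g, f.
Qed.
Lemma card_le_enum (T : finType) (M : {set T}) (U : Type) (f : T -> U) (V : set U) n :
  {in M &, injective f} -> (forall x, x \in M -> V (f x)) -> (V #<= `I_n)%card -> #|M| <= n.
Proof.
move=> fI MV Vn; rewrite -card_le_II.
pose g (i : 'I_#|M|) := f (enum_val i).
have gI : injective g by move=> i j /fI ij; apply/enum_val_inj/ij; exact: enum_valP.
have gV : range g `<=` V by move=> _ [i _ <-]; apply/MV/enum_valP.
apply: card_le_trans Vn; apply: card_le_trans (subset_card_le gV).
rewrite (card_le_eqr (inj_card_eq (A := setT) _)); last by move=> i j _ _; exact: gI.
by rewrite (card_le_eql card_II).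
Qed.

Section BaseSystem.
Variable L : language.
Hypothesis L_unary : forall F : fun_sym L, fun_arity F = 1.
Variable G : lperm_group L.
Variables (A B : structure L) (psi : smap A B) (hat : pmap A -> smap B B).
Hypothesis psi_emb : is_emb G psi.
Hypothesis hat_aut : forall q, is_aut G (hat q).
Hypothesis hat_ext : forall q, pauto G q -> forall a, pdom q a -> hat q (psi a) = psi (pfun q a).
Variables (T : finType) (e : T -> B) (e' : B -> T).
Hypotheses (eK : cancel e e') (e'K : cancel e' e).

Definition pauto_dom (q : pmap A) (a : A) : Prop := pauto G q /\ pdom q a.

(** All embedded copies of [A], with arbitrary language parts, and not only
the translates of [psi A]: this family is invariant under all automorphisms. *)
Definition copies : {set {set T}} :=
  [set C : {set T} | `[< exists f : smap A B, is_emb G f /\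
     forall x : T, x \in C <-> range f (e x) >]]%SET.

Lemma copiesP (C : {set T}) :
  reflect (exists f : smap A B, is_emb G f /\ forall x : T, x \in C <-> range f (e x))
    (C \in copies).
Proof. by rewrite [C \in _]inE; apply: asboolP. Qed.

Definition gen_cl (x : T) : {set T} :=
  [set y | `[< forall W : set B, closed_set W -> W (e x) -> W (e y) >]]%SET.

Lemma gen_clP (x y : T) :
  reflect (forall W : set B, closed_set W -> W (e x) -> W (e y)) (y \in gen_cl x).
Proof. by rewrite [y \in _]inE; apply: asboolP. Qed.

Let hat_inj q : injective (hat q). Proof. by case: (hat_aut q) => -[]. Qed.

Lemma base_act_inj q : injective (fun x => e' (hat q (e x))).
Proof. by move=> x y /(can_inj e'K)/hat_inj/(can_inj eK). Qed.

Definition base_act q : {perm T} := perm (@base_act_inj q).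

Lemma base_actE q x : e (base_act q x) = hat q (e x).
Proof. by rewrite permE e'K. Qed.

Definition base_pt (a : A) : T := e' (psi a).

Lemma gen_cl_refl (C : {set T}) x : C \in copies -> x \in C -> x \in gen_cl x.
Proof. by move=> _ _; apply/gen_clP. Qed.

Lemma gen_cl_trans x y : y \in gen_cl x -> gen_cl y \subset gen_cl x.
Proof.
move=> /gen_clP yx; apply/fintype.subsetP => z /gen_clP zy; apply/gen_clP => W clW Wx.
by apply: zy => //; apply: yx.
Qed.

Lemma copies_cl (C : {set T}) x : C \in copies -> x \in C -> gen_cl x \subset C.
Proof.
move=> /copiesP[f [fe fC]] /fC xf; apply/fintype.subsetP => y /gen_clP yx; apply/fC.
by apply: yx => //; exact: closed_range fe.
Qed.

Lemma base_copy : exists2 C, C \in copies & forall a, base_pt a \in C.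
Proof.
exists [set x | `[< range psi (e x) >]]%SET.
  apply/copiesP; exists psi; split=> // x.
  by rewrite [x \in _]inE; split=> /asboolP.
by move=> a; rewrite inE; apply/asboolP; rewrite e'K; exists a.
Qed.

Lemma act_copies q (C : {set T}) : C \in copies -> base_act q @: C \in copies.
Proof.
move=> /copiesP[f [fe fC]]; apply/copiesP; exists (smap_comp (hat q) f); split.
  by apply: is_emb_comp => //; case: (hat_aut q).
move=> x; split=> [/imsetP[y /fC[a _ ya] ->]|[a _ /= ax]].
  by rewrite base_actE; exists a => //=; rewrite ya.
apply/imsetP; exists (e' (f a)); first by apply/fC; rewrite e'K; exists a.
by apply: (can_inj eK); rewrite base_actE e'K.
Qed.

(** Automorphisms permute the function symbols, and therefore preserve the
family of closed sets, even if they change each single function. *)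
Lemma gen_cl_act q x : gen_cl (base_act q x) = base_act q @: gen_cl x.
Proof.
have [[Gh hI hR hF] [h' hK h'K]] := hat_aut q.
have incl y : y \in gen_cl (base_act q x) -> exists2 z, z \in gen_cl x & y = base_act q z.
  move=> /gen_clP h; exists (e' (h' (e y))); last first.
    by apply: (can_inj eK); rewrite base_actE e'K h'K.
  apply/gen_clP => W clW Wx; rewrite e'K.
  suff : (hat q @` W) (e y) by move=> [z Wz <-]; rewrite hK.
  apply: h; last by rewrite base_actE; exists (e x).
  move=> F _ y' [z Wz <-]; have [F' <-] := lperm_on_fun F Gh.
  rewrite -[[:: hat q z]]/(map (hat q) [:: z]) -hF => -[w zw <-].
  by exists w => //; exact: clW zw.
apply/setP => y; apply/idP/imsetP => [/incl[z zx ->]|[z /gen_clP zx ->]]; first by exists z.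
apply/gen_clP => W clW; rewrite !base_actE => Wx.
apply: (zx (fun b => W (hat q b))) => // F b c Wb bc.
apply: (clW (on_fun (lpart (hat q)) F)) Wb _.
by rewrite -[[:: hat q b]]/(map (hat q) [:: b]) -hF; exists c.
Qed.

Lemma base_act_pt q a : pauto_dom q a -> base_act q (base_pt a) = base_pt (pfun q a).
Proof.
by move=> [pq qa]; apply: (can_inj eK); rewrite base_actE !e'K hat_ext.
Qed.

Lemma gen_cl_base q a x : pauto_dom q a -> x \in gen_cl (base_pt a) ->
  exists2 b, pauto_dom q b & x = base_pt b.
Proof.
move=> [pq qa] /gen_clP h; have [clq _] := pq; have [Gp _ _ pF] := psi_emb.
have [b qb bx] : (psi @` pdom q) (e x).
  apply: h; last by rewrite e'K; exists a.
  move=> F _ y [b qb <-]; have [F' <-] := lperm_on_fun F Gp.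
  rewrite -[[:: psi b]]/(map psi [:: b]) -pF => -[c bc <-].
  by exists c => //; exact: clq bc.
by exists b => //; apply: (can_inj eK); rewrite e'K.
Qed.

Definition base_system : system pauto_dom (@pfun L A) :=
  System gen_cl_refl gen_cl_trans copies_cl base_copy act_copies gen_cl_act
    base_act_pt gen_cl_base.

Lemma base_is_model : @is_model L G A B _ _ _ base_system e.
Proof.
split.
- by move=> C _ x y _ _; exact: (can_inj eK).
- by move=> C /copiesP[f [fe fC]]; exists f => // x /fC.
- move=> F x z xz; exists (e' z); last by rewrite e'K.
  by apply/gen_clP => W clW Wx; rewrite e'K; exact: clW Wx xz.
- by move=> x y /gen_clP.
Qed.

End BaseSystem.

(** * The witness in the class *)

Section Final.
Variable L : language.
Hypothesis L_unary : forall F : fun_sym L, fun_arity F = 1.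
Variable G : lperm_group L.
Implicit Types (A B C D : structure L).

(** The image of [A] in [B] is irreducible, being a member of [K] by
heredity, so the homomorphism-embedding into the completion embeds it. *)
Lemma witness_completion (coh : Prop) (K : structure L -> Prop) A B B' :
    hereditary G K -> (forall A, K A -> irreducible G A) -> K A ->
    is_witness G coh A B -> aut_preserving_completion G B B' ->
  is_witness G coh A B'.
Proof.
move=> Kh Ki KA [psi [hat [pe ha hext hcomp]]] [_ [f [[fh fe] fI [h [h1 h2]]]]].
have sR : is_sub G (range psi) by apply/(is_subP L_unary); exact: closed_range pe.
have [i ie _] : exists2 i : smap (induced (range psi)) A,
    is_emb G i & smap_comp psi i = inclusion (range psi).
  by apply: (lift_emb pe sR) => u; have [a _ e] := set_mem (valP u); exists a.
have fR := fe _ sR (Ki _ (Kh _ _ _ KA ie)).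
have pR a : range psi (psi a) by exists a.
pose j : smap A (induced (range psi)) :=
  SMap (lpart psi) (fun a => SigSub (mem_set (pR a)) : induced (range psi)).
have ij : smap_comp (inclusion (range psi)) j = psi by apply: smap_eq => //=; exact: lmap_comp1l.
have je : is_emb G j by apply: (is_emb_cancel sR); rewrite ij.
exists (smap_comp f psi), (h \o hat); split.
- have := is_emb_comp je fR.
  by rewrite -[in X in _ -> X]ij.
- by move=> q /=; have [] := h1 _ (ha q).
- move=> q pq; have [e1 e2] := hext q pq; have [_ e] := h1 _ (ha q); split=> /=.
    have /= el := congr1 (@lpart _ _ _) e.
    by rewrite lmap_compA el -!lmap_compA e1.
  move=> a qa; have /= ev := congr1 (fun g => vpart g (psi a)) e.
  by rewrite ev e2.
- move=> c q1 q2 q3 p1 p2 p3 p123 /=.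
  by rewrite (hcomp c q1 q2 q3)// h2.
Qed.

Section Witness.
Variables (K : structure L -> Prop) (A B0 : structure L).
Hypothesis K_irreducible : forall A, K A -> irreducible G A.
Variable a0 : A.
Variables (coh : Prop) (psi : smap A B0) (hat : pmap A -> smap B0 B0).
Hypothesis psi_emb : is_emb G psi.
Hypothesis hat_aut : forall q, is_aut G (hat q).
Hypothesis hat_ext : forall q, pauto G q ->
  lmap_comp (lpart (hat q)) (lpart psi) = lmap_comp (lpart psi) (plab q) /\
  forall a, pdom q a -> hat q (psi a) = psi (pfun q a).
Hypothesis hat_comp : coh -> forall q1 q2 q3, pauto G q1 -> pauto G q2 -> pauto G q3 ->
  pcomposite q1 q2 q3 -> hat q3 = smap_comp (hat q2) (hat q1).
Variables (T : finType) (e : T -> B0) (e' : B0 -> T).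
Hypotheses (eK : cancel e e') (e'K : cancel e' e).

Let X0 := base_system psi_emb hat_aut (fun q pq => (hat_ext pq).2) eK e'K.

Variables (Y : system (pauto_dom (A := A) G) (@pfun L A)) (f : Y -> X0).
Hypothesis fc : is_cover f.
Hypothesis cY : conformal Y.

Let p : Y -> B0 := e \o f.
Let YS := model_struct L_unary p.

Definition covered : set YS := [set y | adj (y : Y) y].

(** Vertices outside all edges are dropped: as isolated points they would be
irreducible substructures that need not embed into [A]. *)
Definition covered_struct : structure L := induced covered.

Let pm : is_model G p.
Proof. by apply: (model_cover fc); exact: base_is_model. Qed.

Let covered_sub : is_sub G covered.
Proof.
apply/(is_subP L_unary) => F x y xx [yx _]; have xy := adj_cl xx yx.
by rewrite /covered /= (adj_refll (y := x))// adj_sym.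
Qed.

Let val_adj (u : covered_struct) : adj (val u : Y) (val u).
Proof. exact: set_mem (valP u). Qed.

Lemma covered_finite : finite_structure covered_struct.
Proof.
have : finite_set ((val : covered_struct -> Y) @` setT) by exact: finite_finset.
by rewrite (eq_finite_set (inj_card_eq _))// => x y _ _; exact: val_inj.
Qed.

Lemma covered_irreducible (U : set covered_struct) : is_sub G U -> irreducible G (induced U) ->
  exists i : smap (induced U) A, is_emb G i.
Proof.
move=> sU irr; have ve := is_emb_comp sU covered_sub.
have [S [cS vS SE]] := irreducible_image ve (fun u => val_adj _) irr.
exact: face_lift pm (cY cS) ve vS.
Qed.

Lemma covered_projection : exists h : smap covered_struct B0, is_hom_emb G h.
Proof.
exists (@SMap L covered_struct B0 (lmap_id L) (p \o (fun u => val u))).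
apply: (clique_emb_hom_emb (p := p) (U := finset.setT) covered_sub).
- by move=> d; rewrite inE.
- exact: val_adj.
split; first exact: lpg_id.
by move=> S _ cS; apply: face_emb pm (cY cS).
Qed.

(** The third condition of local finiteness.  The set [M] of vertices of [U]
in [Y] is closed in the sense of the system by [closed_of_closed_set]. *)
Lemma covered_small n (U : set covered_struct) :
    (forall M : {set Y}, #|M| <= n -> closed M -> {in M, forall x, adj x x} ->
      completable L_unary G K p M) ->
    is_sub G U -> (U #<= `I_n)%card ->
  exists2 C, K C & completion G (induced U) C.
Proof.
move=> hcompl sU Un; have ve := is_emb_comp sU covered_sub.
pose M : {set Y} := [set y | `[< exists u : induced U, val (val u) = y >]]%SET.
have ME y : y \in M -> exists u : induced U, val (val u) = y.
  by rewrite [y \in M]inE => h; apply/asboolP.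
have MP (u : induced U) : (val (val u) : Y) \in M.
  by rewrite [_ \in M]inE; apply/asboolP; exists u.
have Mn : #|M| <= n.
  have /choice[g hg] : forall y : Y, exists u : covered_struct, y \in M -> U u /\ val u = y.
    move=> y; have [/ME[u <-]|yM] := boolP (y \in M).
      by exists (val u) => _; split=> //; exact: set_mem (valP u).
    have b : covered (base Y a0).
      by have [C CY bC] := base_edge Y; apply/adjP; exists C.
    by exists (SigSub (mem_set b)).
  apply: (card_le_enum (f := g) _ _ Un).
    by move=> x y xM yM exy; rewrite -(hg x xM).2 -(hg y yM).2 exy.
  by move=> x /hg[].
have rM : {in M, forall x, adj x x} by move=> x /ME[u <-]; exact: val_adj.
have cM : closed M.
  apply: (closed_of_closed_set pm rM) => F x y /ME[u <-] xy; apply/set_mem/mem_set.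
  have [_ _ _ vF] := ve.
  have [w _ <-] : ((fun u : induced U => val (val u) : Y) @` fun_in F [:: u]) y.
    exact: (eq_ind_r (fun S : set Y => S y) xy (vF F [:: u])).
  exact: MP.
have [C [g [s [KC gC]]]] := hcompl M Mn cM rM.
exists C => //; split; first exact: K_irreducible.
exists (@SMap L (induced U) C s (g \o (fun u => val (val u)))).
exact: (clique_emb_hom_emb ve MP (fun u => val_adj _) gC).
Qed.

Let act_adj q (x y : Y) : adj (act Y q x) (act Y q y) = adj x y.
Proof.
apply/adjP/adjP => -[C [CY xC yC]].
  exists (act Y q @^-1: C)%SET; rewrite !inE; split=> //.
  exact: act_preimset_edge.
by exists (act Y q @: C); rewrite !imset_f// act_edge.
Qed.

Let act_covered q (u : covered_struct) : covered (act Y q (val u)).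
Proof. exact: etrans (act_adj q _ _) (val_adj u). Qed.

Definition covered_hat q : smap covered_struct covered_struct :=
  @SMap L covered_struct covered_struct (lpart (hat q))
    (fun u => SigSub (mem_set (act_covered q u))).

Let p_act q y : p (act Y q y) = hat q (p y).
Proof. by rewrite /p /= (cover_act fc) base_actE. Qed.

Let act_emb q : is_emb G (@SMap L YS YS (lpart (hat q)) (act Y q)).
Proof.
have [[Gh hI hR hF] _] := hat_aut q.
split=> //=; first exact: perm_inj.
- move=> R x; rewrite /model_rel /= -map_comp.
  have -> : map (p \o act Y q) x = map (hat q) (map p x).
    by rewrite -map_comp; apply: eq_map => y /=; exact: p_act.
  rewrite -hR (_ : face [set y in map (act Y q) x]%SET = face [set y in x]%SET)//.
  have -> : [set y in map (act Y q) x]%SET = act Y q @: [set y in x]%SET.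
    apply/setP => z; rewrite inE; apply/mapP/imsetP => -[y]; rewrite ?inE => yx ->.
      by exists y; rewrite ?inE.
    by exists y => //; rewrite inE in yx.
  have subE (S C : {set Y}) : (act Y q @: S \subset act Y q @: C) = (S \subset C).
    apply/idP/idP => [/fintype.subsetP h|]; last exact: imsetS.
    apply/fintype.subsetP => z zS; have := h _ (imset_f (act Y q) zS).
    by rewrite mem_imset//; exact: perm_inj.
  apply/faceP/faceP => -[C CY sC].
    exists (act Y q @^-1: C)%SET; last by rewrite -sub_imset_pre.
    exact: act_preimset_edge.
  by exists (act Y q @: C); rewrite ?act_edge ?subE.
apply: (emb_funP L_unary (A := YS) (B := YS) (s := lpart (hat q)) (f := act Y q)) => x F /=.
apply/seteqP; split=> [_ [y [yx xy] <-]|z /=].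
  split; first by rewrite act_cl imset_f.
  by rewrite !p_act -[[:: hat q _]]/(map (hat q) [:: p x]) -hF; exists (p y).
rewrite act_cl p_act -[[:: hat q _]]/(map (hat q) [:: p x]) -hF => -[/imsetP[y yx ->]].
by rewrite p_act => -[b xb /hI bE]; exists y => //; split=> //; rewrite -bE.
Qed.

Lemma covered_hat_aut q : is_aut G (covered_hat q).
Proof.
have fe : is_emb G (covered_hat q).
  apply: (is_emb_cancel covered_sub).
  have := is_emb_comp covered_sub (act_emb q).
  by congr (is_emb G _); apply: smap_eq => //=; rewrite lmap_comp1l lmap_comp1r.
split=> //.
have inv (u : covered_struct) : covered ((act Y q)^-1%g (val u : Y)).
  by rewrite /covered /= -(act_adj q) permKV; exact: val_adj.
exists (fun u => SigSub (mem_set (inv u))) => u; apply: val_inj => /=; first exact: permK.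
exact: permKV.
Qed.

Let base_covered a : covered (base Y a).
Proof. by have [C CY bC] := base_edge Y; apply/adjP; exists C. Qed.

Definition covered_psi : smap A covered_struct :=
  @SMap L A covered_struct (lpart psi) (fun a => SigSub (mem_set (base_covered a))).

Lemma covered_psi_emb : is_emb G covered_psi.
Proof.
have [C CY bC] := base_edge Y.
have fC : face C by apply/faceP; exists C.
have clC : closed C by apply/closedP => x; exact: edge_cl.
have ie := inclusion_emb L_unary G p clC.
have pe := emb_on_comp L_unary ie (fun u => set_mem (valP u)) (face_emb L_unary pm fC).
pose j : smap A (induced (A := YS) [set` C]) := SMap (lpart psi)
  (fun a => SigSub (mem_set (bC a : [set` C] (base Y a))) : induced (A := YS) [set` C]).
have je : is_emb G j.
  apply: (is_emb_cancel pe); move: psi_emb; congr (is_emb G _).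
  apply: smap_eq => /=; first by case: (lpart psi).
  by move=> a; rewrite /p /= (cover_base fc) /= e'K.
apply: (is_emb_cancel covered_sub); have := is_emb_comp je ie.
by congr (is_emb G _); exact: smap_eq.
Qed.

Lemma covered_witness : is_witness G coh A covered_struct.
Proof.
exists covered_psi, covered_hat; split.
- exact: covered_psi_emb.
- exact: covered_hat_aut.
- move=> q pq; have [e1 _] := hat_ext pq; split=> // a qa.
  by apply: val_inj => /=; rewrite act_base.
move=> c q1 q2 q3 p1 p2 p3 p123.
have e123 := hat_comp c p1 p2 p3 p123; have [c1 c2 c3 c4] := p123.
apply: smap_eq => /=; first by rewrite e123.
move=> u; apply: val_inj => /=; apply: (cover_comp fc).
- by move=> a; split=> -[_ qa]; split=> //; apply/c1.
- move=> b; split=> [[_ qb]|[a [_ qa] ab]].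
    by have /c2[a qa ab] := qb; exists a.
  by split=> //; apply/c2; exists a.
- by move=> a [_]; exact: c3.
- by move=> y; apply: (can_inj eK); rewrite !base_actE e123.
Qed.

End Witness.

(** The empty structure is its own witness and is treated apart, because the
total maps used above need values in [A]. *)
Lemma witness_in_class (coh : Prop) (E K : structure L -> Prop) A B0 :
    (forall A, E A -> finite_structure A) -> hereditary G K ->
    locally_finite_aut_preserving G E K -> strong_amalgamation_property G K ->
    K A -> E B0 -> is_witness G coh A B0 ->
  exists2 B, K B & is_witness G coh A B.
Proof.
move=> Ef Kh [KE Ki Klf] Ks KA EB w.
have [[a0 _]|noA] := pselect (exists a : A, True); last first.
  exists A => //; exists (SMap (lmap_id L) id).
  have void (a : A) : False by apply: noA; exists a.
  have norel R (x : seq A) : ~ rel_in R x.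
    move=> /rel_in_size; case: x => [|a]; last by case: (void a).
    by move=> s0; have := rel_arity_gt0 R; rewrite -s0.
  have pG (q : pmap A) : pauto G q -> G (plab q) by case=> _ [].
  exists (fun q => if pselect (G (plab q)) then SMap (plab q) id else SMap (lmap_id L) id).
  split.
  - by have [] := is_aut_id G A.
  - move=> q; case: (pselect _) => [Gq|nGq] /=; last exact: is_aut_id.
    split; last by exists id.
    split=> //= [R x|F x].
      by split=> h; case: (norel _ _ h).
    by apply/seteqP; split=> y; case: (void y).
  - move=> q pq; have Gq := pG _ pq; case: (pselect (G (plab q))) => //= Gq'.
  - move=> _ q1 q2 q3 p1 p2 p3 [_ _ _ c4].
    have G1 := pG _ p1; have G2 := pG _ p2; have G3 := pG _ p3.
    case: (pselect (G (plab q3))) => //= _; case: (pselect (G (plab q2))) => //= _.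
    by case: (pselect (G (plab q1))) => //= _; apply: smap_eq.
have [psi [hat [pe ha hext hcomp]]] := w.
have [T [e [e' [eK e'K]]]] := finite_set_finType (psi a0) (Ef _ EB).
have [n hn] := Klf A B0 KA EB.
have [Y [f [fc cY hcompl]]] := completable_cover L_unary Kh Ks KA a0 n
  (base_is_model pe ha (fun q pq => (hext q pq).2) eK e'K).
have [|U sU irr||U sU Un|B' KB' compB'] := hn (covered_struct f).
- exact: covered_finite.
- exact: covered_irreducible fc cY _ sU irr.
- exact: covered_projection fc cY.
- by have := covered_small Ki a0 fc hcompl sU Un.
exists B' => //; apply: (witness_completion Kh Ki KA _ compB').
exact: covered_witness.
Qed.

End Final.

Theorem theorem1p6 (L : language)
    (L_unary : forall F : fun_sym L, fun_arity F = 1)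
    (G : lperm_group L)
    (E K : structure L -> Prop)
    (E_finite : forall A, E A -> finite_structure A)
    (E_EPPA : has_EPPA G E)
    (K_hereditary : hereditary G K)
    (K_locally_finite : locally_finite_aut_preserving G E K)
    (K_strong_amalg : strong_amalgamation_property G K)
    (K_irreducible : forall A, K A -> irreducible G A) :
  has_EPPA G K /\ (has_coherent_EPPA G E -> has_coherent_EPPA G K).
Proof.
have [KE _ _] := K_locally_finite.
have step (coh : Prop) A B0 : K A -> E B0 -> is_witness G coh A B0 ->
    exists2 B, K B & EPPA_witness G A B /\ (coh -> coherent_EPPA_witness G A B).
  move=> KA EB0 w.
  have [B KB wB] := witness_in_class L_unary E_finite K_hereditary K_locally_finite
    K_strong_amalg KA EB0 w.
  exists B => //; apply: witness_intro => //.
    exact: E_finite (KE _ KA).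
  exact: E_finite (KE _ KB).
split=> [A KA|E_coherent A KA].
  have [B0 EB0 w] := E_EPPA A (KE A KA).
  have [B KB [wB _]] := step False A B0 KA EB0 (EPPA_is_witness L_unary w).
  by exists B.
have [B0 EB0 w] := E_coherent A (KE A KA).
have [B KB [_ wB]] := step True A B0 KA EB0 (coherent_EPPA_is_witness L_unary w).
by exists B => //; exact: wB.
Qed.
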